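(* Let $l,N\ge1$ and let $\mu=(\mu_1,\dots,\mu_l)$ and $\lambda=(\lambda_1,\dots,\lambda_{l+N})$ be generalized partitions with $\mu\subset\lambda$. Then $${\rm sp}_{\lambda/\mu}(x^{\pm})=\sum_{\mu=z_0\prec z_1\prec\cdots\prec z_{2N}=\lambda}\ \prod_{i=1}^N x_i^{2|z_{2i-1}|-|z_{2i}|-|z_{2i-2}|},$$ $${\rm o}_{\lambda/\mu}(x^{\pm})=\sum_{\mu=z'_0\prec z'_1\prec\cdots\prec z'_{2N}=\lambda}\ \prod_{i=1}^N\big(1+\delta_{z'_{2i,l+i}>0}\,\delta_{z'_{2i-2,l+i-1},0}\big)\,x_i^{2|z'_{2i-1}|-|z'_{2i}|-|z'_{2i-2}|}.$$ In the first sum, the $z_k=(z_{k,1},\dots,z_{k,l+\lceil k/2\rceil})$ ($0\le k\le 2N$) are generalized partitions satisfying the symplectic Gelfand--Tsetlin pattern $$z_{k+1,j}\le z_{k,j-1}\le z_{k+1,j-1}\quad\text{for } 2\le j\le l+\lceil (k+1)/2\rceil .$$ In the second sum, the $z'_k=(z'_{k,1},\dots,z'_{k,l+\lceil k/2\rceil})$ ($0\le k\le 2N$) are generalized partitions satisfying the orthogonal Gelfand--Tsetlin pattern $$z'_{k+1,j}\le z'_{k,j-1}\le z'_{k+1,j-1}\quad\text{for } 2\le j\le l+\lceil (k+1)/2\rceil,$$ subject to $z'_{2i-1,l+i}\in\{0,\min\{z'_{2i,l+i},z'_{2i-2,l+i-1}\}\}$ for $1\le i\le N$.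
   Context: A generalized partition $\lambda=(\lambda_1,\dots,\lambda_n)$ is a finite weakly decreasing sequence of nonnegative integers (zeros allowed; the number $n$ of entries is part of the data); $|\lambda|=\sum_i\lambda_i$. $\mu\subset\lambda$ means $\lambda_i\ge\mu_i$ for all $i$. Interlacing $\nu\prec\lambda$ means $\lambda_i\ge\nu_i\ge\lambda_{i+1}$ for all $i\ge1$, where entries beyond the last one are read as $0$ (in particular, if $\nu$ and $\lambda$ both have $m$ entries, then also $\nu_m\le\lambda_m$ is required). $\delta_{a>0}$ is $1$ if $a>0$ and $0$ otherwise; $\delta_{a,0}$ is $1$ if $a=0$ and $0$ otherwise. Let $x^\pm=(x_1,x_1^{-1},\dots,x_N,x_N^{-1})$ and define $h_m(x^{\pm})$ by $\prod_{i=1}^N\frac{1}{(1-x_iz)(1-x_i^{-1}z)}=\sum_{m\in\mathbb Z}h_m(x^{\pm})z^m$ (so $h_m(x^\pm)=0$ for $m<0$). Skew symplectic Schur function: ${\rm sp}_{\lambda/\mu}(x^{\pm})=\det(a_{ij})_{1\le i,j\le l+N}$, where (with $\mu_{l+1}=0$) $a_{ij}=h_{\lambda_i-\mu_j-i+j}(x^{\pm})$ for $1\le j\le l+1$ and $a_{ij}=h_{\lambda_i-i+j}(x^{\pm})+h_{\lambda_i-i-j+2l+2}(x^{\pm})$ for $l+2\le j\le l+N$. Skew orthogonal Schur function: ${\rm o}_{\lambda/\mu}(x^{\pm})=\det(b_{ij})_{1\le i,j\le l+N}$, where $b_{ij}=h_{\lambda_i-\mu_j-i+j}(x^{\pm})$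 for $1\le j\le l$ and $b_{ij}=h_{\lambda_i-i+j}(x^{\pm})-h_{\lambda_i-i-j+2l}(x^{\pm})$ for $l+1\le j\le l+N$. *)

(* Defs.v *)
From HB Require Import structures.
From mathcomp Require Import all_boot all_order all_algebra.

Set Implicit Arguments.
Unset Strict Implicit.
Unset Printing Implicit Defensive.

Import Order.TTheory GRing.Theory Num.Theory.
Local Open Scope ring_scope.

(* Coefficients of the power series 1 / p, for p with invertible constant     *)
(* term; inv_coefs p n lists the first n of them.                             *)
Fixpoint inv_coefs (R : comUnitRingType) (p : {poly R}) (n : nat) : seq R :=
  if n is k.+1 then
    let s := inv_coefs p k in
    rcons s ((p`_0)^-1 * ((k == 0%N)%:R - \sum_(i < k) p`_(k - i) * s`_i))
  else [::].

Definition inv_series (R : comUnitRingType) (p : {poly R}) (n : nat) : R :=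
  (inv_coefs p n.+1)`_n.

Lemma size_inv_coefs (R : comUnitRingType) (p : {poly R}) n :
  size (inv_coefs p n) = n.
Proof. by elim: n => //= n IHn; rewrite size_rcons IHn. Qed.

Lemma nth_inv_coefs (R : comUnitRingType) (p : {poly R}) n i :
  (i < n)%N -> (inv_coefs p n)`_i = inv_series p i.
Proof.
elim: n => // n IHn; rewrite ltnS leq_eqVlt => /predU1P[-> //|lt_in].
by rewrite /= nth_rcons size_inv_coefs lt_in IHn.
Qed.

Lemma inv_seriesP (R : comUnitRingType) (p : {poly R}) n :
  p`_0 \is a GRing.unit ->
  \sum_(i < n.+1) p`_(n - i) * inv_series p i = (n == 0%N)%:R.
Proof.
move=> p0U; rewrite big_ord_recr /= subnn {2}/inv_series /=.
rewrite nth_rcons size_inv_coefs ltnn eqxx mulrA mulrV // mul1r addrC.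
rewrite [X in _ - X](eq_bigr (fun i : 'I_n => p`_(n - i) * inv_series p i)).
  by rewrite subrK.
by move=> i _; rewrite nth_inv_coefs.
Qed.

(* h_m(x_1, 1/x_1, ..., x_N, 1/x_N)                                           *)
Definition hsym (R : comUnitRingType) (N : nat) (x : 'I_N -> R) (m : int) : R :=
  if m is Posz n then
    inv_series (\prod_(i < N) ((1 - x i *: 'X) * (1 - (x i)^-1 *: 'X))) n
  else 0.

(* Entries are numbered from 1 and read as 0 beyond the last one; part s 0 is *)
(* meaningless.                                                               *)
Definition part (s : seq nat) (i : nat) : nat := nth 0%N s i.-1.

Definition gpart (n : nat) (s : seq nat) : bool :=
  (size s == n) && sorted geq s.

Definition subpart (mu la : seq nat) : Prop :=
  forall i : nat, (0 < i)%N -> (part mu i <= part la i)%N.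

Definition interlace (nu la : seq nat) : bool :=
  [forall i : 'I_(maxn (size nu) (size la)).+1,
     (0 < i)%N ==> (part la i.+1 <= part nu i <= part la i)%N].

Lemma interlaceP (nu la : seq nat) :
  reflect (forall i, (0 < i)%N -> (part la i.+1 <= part nu i <= part la i)%N)
          (interlace nu la).
Proof.
apply: (iffP forallP) => [H i i_gt0 | H i]; last by apply/implyP; apply: H.
have [le_im | lt_mi] := leqP i (maxn (size nu) (size la)).
  exact: (implyP (H (Ordinal (le_im : (i < _.+1)%N)))).
rewrite gtn_max in lt_mi; case/andP: lt_mi => lt1 lt2.
case: i i_gt0 lt1 lt2 {H} => // i _; rewrite !ltnS => le1 le2.
by rewrite /part /= !nth_default // leqW.
Qed.

(* In the two entry functions below, i and j are numbered from 1.             *)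
Definition sp_entry (R : comUnitRingType) (l N : nat) (x : 'I_N -> R)
    (la mu : seq nat) (i j : nat) : R :=
  if (j <= l.+1)%N then
    hsym x ((part la i)%:Z - (part mu j)%:Z - i%:Z + j%:Z)
  else hsym x ((part la i)%:Z - i%:Z + j%:Z)
       + hsym x ((part la i)%:Z - i%:Z - j%:Z + (2 * l + 2)%N%:Z).

Definition skew_sp (R : comUnitRingType) (l N : nat) (x : 'I_N -> R)
    (la mu : seq nat) : R :=
  \det (\matrix_(i < l + N, j < l + N) sp_entry l x la mu i.+1 j.+1).

Definition o_entry (R : comUnitRingType) (l N : nat) (x : 'I_N -> R)
    (la mu : seq nat) (i j : nat) : R :=
  if (j <= l)%N then
    hsym x ((part la i)%:Z - (part mu j)%:Z - i%:Z + j%:Z)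
  else hsym x ((part la i)%:Z - i%:Z + j%:Z)
       - hsym x ((part la i)%:Z - i%:Z - j%:Z + (2 * l)%N%:Z).

Definition skew_o (R : comUnitRingType) (l N : nat) (x : 'I_N -> R)
    (la mu : seq nat) : R :=
  \det (\matrix_(i < l + N, j < l + N) o_entry l x la mu i.+1 j.+1).

Definition chain (l N : nat) (mu la : seq nat) (z : nat -> seq nat) : bool :=
  [&& [forall k : 'I_(2 * N).+1, gpart (l + uphalf k) (z k)],
      z 0%N == mu, z (2 * N)%N == la
    & [forall k : 'I_(2 * N), interlace (z k) (z k.+1)]].

Definition gt_ineqs (l N : nat) (z : nat -> seq nat) : bool :=
  [forall k : 'I_(2 * N), forall j : 'I_(l + uphalf k.+1).+1,
     (2 <= j)%N ==>
     (part (z k.+1) j <= part (z k) (j - 1) <= part (z k.+1) (j - 1))%N].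

Definition sp_pattern (l N : nat) (mu la : seq nat) (z : nat -> seq nat) : bool :=
  chain l N mu la z && gt_ineqs l N z.

Definition o_pattern (l N : nat) (mu la : seq nat) (z : nat -> seq nat) : bool :=
  [&& chain l N mu la z, gt_ineqs l N z
    & [forall i : 'I_N.+1, (1 <= i)%N ==>
        (part (z (2 * i - 1)%N) (l + i) \in
          [:: 0%N; minn (part (z (2 * i)%N) (l + i))
                        (part (z (2 * i - 2)%N) (l + i - 1))])]].

(* A finite type to sum over. By chain_array below, every chain ending at la  *)
(* is given by exactly one array, so the bounds on the lengths and the        *)
(* entries do not restrict the sum.                                           *)
Definition array (l N : nat) (la : seq nat) : finType :=
  {ffun 'I_(2 * N).+1 -> (l + N).-bseq 'I_(part la 1).+1}.

Definition rows (l N : nat) (la : seq nat) (t : array l N la) (k : nat) : seq nat :=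
  map val (t (inord k)).

Lemma chain_bound l N mu la z k i :
  chain l N mu la z -> (k <= 2 * N)%N -> (part (z k) i <= part la 1)%N.
Proof.
case/and4P=> /forallP Hp _ /eqP <- /forallP Hi le_k.
have first j : (part (z k) j <= part (z k) 1)%N.
  have /andP[_ srt] := Hp (Ordinal (le_k : (k < (2 * N).+1)%N)).
  rewrite /part /=; case: (ltnP j.-1 (size (z k))) => [lt_j | ge_j]; last first.
    by rewrite (nth_default _ ge_j).
  have tr : transitive geq by move=> a b c /= h1 h2; apply: leq_trans h1.
  have rf : reflexive geq by move=> a; apply: leqnn.
  apply: (sorted_leq_nth tr rf 0%N srt 0%N j.-1) => //.
  exact: leq_ltn_trans lt_j.
apply: leq_trans (first i) _.
move: {first i}(2 * N - k)%N (subnK le_k) => d.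
elim: d k le_k => [|d IHd] k le_k; first by rewrite add0n => <-.
rewrite addSnnS => e; have lt_k : (k < 2 * N)%N by rewrite -e leq_addl.
have /interlaceP/(_ 1%N isT)/andP[_ le1] := Hi (Ordinal lt_k).
exact: leq_trans le1 (IHd _ lt_k e).
Qed.

Lemma chain_array l N mu la z :
  chain l N mu la z ->
  exists! t : array l N la, forall k, (k <= 2 * N)%N -> rows t k = z k.
Proof.
move=> cz; have bound := chain_bound _ cz.
have size_z k : (k <= 2 * N)%N -> (size (z k) <= l + N)%N.
  move=> le_k; case/and4P: cz => /forallP Hp _ _ _.
  have /andP[/eqP-> _] := Hp (Ordinal (le_k : (k < (2 * N).+1)%N)).
  by rewrite leq_add2l /= leq_uphalf_double -mul2n.
pose t : array l N la := [ffun k : 'I_(2 * N).+1 =>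
  insub_bseq (l + N) (map (fun a => inord a : 'I_(part la 1).+1) (z k))].
have tP k : (k <= 2 * N)%N -> rows t k = z k.
  move=> le_k; rewrite /rows ffunE inordK //.
  rewrite /insub_bseq val_insubd size_map size_z // -map_comp.
  apply: map_id_in => a /(nthP 0%N)[i lt_i <-] /=.
  by rewrite inordK // ltnS; apply: (bound k i.+1).
exists t; split=> // t' t'P; apply/ffunP=> k; apply: val_inj.
apply: (inj_map val_inj).
have le_k : (k <= 2 * N)%N by rewrite -ltnS.
by have := tP k le_k; rewrite -(t'P k le_k) /rows inord_val.
Qed.

(* x_i ^ (2|z_{2i-1}| - |z_{2i}| - |z_{2i-2}|), with i numbered from 1        *)
Definition weight (R : comUnitRingType) (xi : R) (z : nat -> seq nat) (i : nat) : R :=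
  xi ^ (2 * (sumn (z (2 * i - 1)%N))%:Z - (sumn (z (2 * i)%N))%:Z
        - (sumn (z (2 * i - 2)%N))%:Z).

Definition o_factor (l : nat) (z : nat -> seq nat) (i : nat) : nat :=
  (1 + (0 < part (z (2 * i)) (l + i))
       * (part (z (2 * i - 2)) (l + i - 1) == 0))%N.

(* Main.v *)
Require Import Defs.
From HB Require Import structures.
From mathcomp Require Import all_boot all_order all_algebra.
From mathcomp Require Import zify ring.

(** Both determinants have one shape.  Number positions from the bottom, so
    that row i of a generalized partition la with n entries sits at position
    a_i = la_i + (n - 1 - i); the column functions are then the coefficient
    sequences of the power series p_j(t) / P_N(t), where
    P_N = prod_i (1 - x_i t)(1 - t / x_i) and the p_j are explicit polynomials
    (monomials for the entries of mu, and for one more entry 0 in the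
    symplectic case; for the other columns, t^(N-1-k) + t^(N-1+k) in the
    symplectic case and t^(N-k) - t^(N+k) in the orthogonal case, with k > 0).
    So skdet n p Q la, the determinant of the coefficients of p_j / Q at the
    positions of la, is the object to study, and the theorem is an induction
    on N that removes the two factors of P_N containing the last variable.

    Removing one linear factor is a row operation.  If F = p / ((1 - ut) Q)
    and f = p / Q, then F(a) - u^(a-a') F(a') is the sum of u^(a-b) f(b) over
    a' < b <= a.  Subtracting u^(a_i - a_(i+1)) times row i+1 from row i thus
    turns row i into a sum over b in the interval (a_(i+1), a_i], which is
    exactly the interlacing condition, and expanding by multilinearity gives
    a sum over interlacing partitions weighted by u^(|la| - |kappa|).  There
    are two versions: one that shortens the partition because one column is
    Q itself, so that F is geometric and gets killed in every row but the last
    (skdet_strip_last), and one that keeps the length (skdet_strip).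

    To pass from N + 1 to N the last column must be simplified.  The
    polynomial P_N is palindromic, hence a combination of the symplectic
    numerators in which the last one has coefficient 1; so that last numerator
    may be replaced by P_N, and the remaining columns are t times those for N.
    Removing 1 - t / y and then 1 - y t gives the two interlacing steps
    of the symplectic pattern (skdet_spcolS).

    In the orthogonal case (1 - t^2) P_N plays the same role, and
    1 - t^2 = A + B - A B for A = 1 - y t and B = 1 - t / y.  At positive
    positions the last column is therefore a sum of two geometric ones, and
    the determinant is S(y) + S(1/y), with the second term absent when the
    last part of la is 0 (skdet_ocolS_sym); S(y) sums over
    chains nu, z, la in which z has one part less than in the statement.  The
    term S(y) accounts for patterns with last entry 0.  For S(1/y), fix la and nu: each z_i ranges
    over an interval [lo_i, hi_i] independently, and the reflection
    z_i -> lo_i + hi_i - z_i turns it into the sum over patterns whose last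
    entry is the minimum (sum_wt2_reflect).  When this minimum is 0 both kinds
    coincide, which is where the factor 2 comes from.

    The sums over arrays finally satisfy the same recursion on N
    (path_sumS), with the same value at N = 0 (skdet_base). *)

Set Implicit Arguments.
Unset Strict Implicit.
Unset Printing Implicit Defensive.

Import Order.TTheory GRing.Theory Num.Theory.
Local Open Scope ring_scope.

(** * Quotients of power series *)

(** The coefficient of t^a in the power series p / Q. *)
Definition quo (R : comUnitRingType) (p Q : {poly R}) (a : nat) : R :=
  \sum_(s < a.+1) p`_s * inv_series Q (a - s).

Lemma eq_coefM (R : comUnitRingType) (p p' q q' : {poly R}) m :
  (forall i, (i < m)%N -> p`_i = p'`_i) -> (forall i, (i < m)%N -> q`_i = q'`_i) ->
  forall i, (i < m)%N -> (p * q)`_i = (p' * q')`_i.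
Proof.
move=> ep eq i lt_i; rewrite !coefM; apply: eq_bigr => j _.
by rewrite ep ?eq //; have := ltn_ord j; lia.
Qed.

Lemma quoE (R : comUnitRingType) (p Q : {poly R}) m a :
  (a < m)%N -> quo p Q a = (p * \poly_(i < m) inv_series Q i)`_a.
Proof.
move=> lt_a; rewrite coefM; apply: eq_bigr => j _.
by rewrite coef_poly (leq_ltn_trans (leq_subr _ _) lt_a).
Qed.

Lemma inv_series_mul (R : comUnitRingType) (Q : {poly R}) m i :
  Q`_0 = 1 -> (i < m)%N ->
  (Q * \poly_(i < m) inv_series Q i)`_i = (1 : {poly R})`_i.
Proof.
move=> Q0 lt_i; rewrite coefMr coef1 -(inv_seriesP i (p := Q)) ?Q0 ?unitr1 //.
apply: eq_bigr => j _; rewrite coef_poly ifT //; have := ltn_ord j; lia.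
Qed.

(** Power series are handled through polynomials known up to degree m: any g with
    Q g = p there computes p / Q there. *)
Lemma quo_unique (R : comUnitRingType) (p Q g : {poly R}) m :
  Q`_0 = 1 -> (forall i, (i < m)%N -> (Q * g)`_i = p`_i) ->
  forall i, (i < m)%N -> quo p Q i = g`_i.
Proof.
move=> Q0 Qg i lt_i; rewrite (quoE _ _ lt_i) -[g in RHS]mul1r.
rewrite -(eq_coefM Qg (fun _ _ => erefl) lt_i).
rewrite mulrAC; apply: (@eq_coefM _ _ _ _ _ m) => // j; exact: inv_series_mul.
Qed.

Lemma quoD (R : comUnitRingType) (p q Q : {poly R}) a :
  quo (p + q) Q a = quo p Q a + quo q Q a.
Proof. by rewrite -big_split; apply: eq_bigr => i _; rewrite coefD mulrDl. Qed.

Lemma quoZ (R : comUnitRingType) c (p Q : {poly R}) a :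
  quo (c *: p) Q a = c * quo p Q a.
Proof. by rewrite mulr_sumr; apply: eq_bigr => i _; rewrite coefZ mulrA. Qed.

Lemma quoB (R : comUnitRingType) (p q Q : {poly R}) a :
  quo (p - q) Q a = quo p Q a - quo q Q a.
Proof. by rewrite -scaleN1r quoD quoZ mulN1r. Qed.

Lemma quo_sum (R : comUnitRingType) n (c : 'I_n -> R) (p : 'I_n -> {poly R}) Q a :
  quo (\sum_i c i *: p i) Q a = \sum_i c i * quo (p i) Q a.
Proof.
under [RHS]eq_bigr do rewrite -quoZ.
apply: (big_morph (fun p => quo p Q a)) => [p' q'|]; first exact: quoD.
by rewrite /quo big1 // => i _; rewrite coef0 mul0r.
Qed.

Lemma quoM (R : comUnitRingType) (p Q : {poly R}) a :
  Q`_0 = 1 -> quo (Q * p) Q a = p`_a.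
Proof. by move=> Q0; apply: (@quo_unique _ _ _ _ a.+1). Qed.

Lemma quoX0 (R : comUnitRingType) (p Q : {poly R}) : quo ('X * p) Q 0 = 0.
Proof. by rewrite /quo big_ord1 coefXM mul0r. Qed.

Lemma quoXS (R : comUnitRingType) (p Q : {poly R}) a :
  quo ('X * p) Q a.+1 = quo p Q a.
Proof.
rewrite /quo big_ord_recl coefXM mul0r add0r; apply: eq_bigr => i _.
by rewrite coefXM.
Qed.

Lemma quoXn (R : comUnitRingType) s (Q : {poly R}) a :
  quo 'X^s Q a = if (s <= a)%N then inv_series Q (a - s) else 0.
Proof.
rewrite /quo; case: leqP => h.
  rewrite (bigD1 (inord s)) //= inordK // coefXn eqxx mul1r big1 ?addr0 // => i.
  move=> ne; rewrite coefXn; case: eqP => [e|]; rewrite ?mul0r //.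
  by case/eqP: ne; rewrite -e inord_val.
by rewrite big1 // => i _; rewrite coefXn ltn_eqF ?mul0r //; have := ltn_ord i; lia.
Qed.

(** The linear factors of the denominators, written as in the definition of the
    complete symmetric functions. *)
Definition lin (R : comUnitRingType) (u : R) : {poly R} := 1 - u *: 'X.

Lemma coef0_lin (R : comUnitRingType) (u : R) Q : (lin u * Q)`_0 = Q`_0.
Proof. by rewrite coef0M coefB coef1 coefZ coefX mulr0 subr0 mul1r. Qed.

(** Multiplying by 1 - ut recovers p / Q from p / ((1 - ut) Q).  The extra factor
    t makes the recursion start at 0 without a special case. *)
Lemma quo_lin (R : comUnitRingType) (u : R) (p Q : {poly R}) a :
  Q`_0 = 1 ->
  quo ('X * p) (lin u * Q) a.+1 = u * quo ('X * p) (lin u * Q) a + quo p Q a.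
Proof.
move=> Q0; set W := lin u * Q.
have W0 : W`_0 = 1 by rewrite coef0_lin.
pose g := p * \poly_(i < a.+1) inv_series W i.
have e : forall i, (i < a.+1)%N -> quo p Q i = (lin u * g)`_i.
  apply: quo_unique => // i lt_i; rewrite /g !mulrA -[p in RHS]mul1r mulrAC.
  rewrite (mulrC Q) -/W; apply: (@eq_coefM _ _ _ _ _ a.+1) => // j.
  exact: inv_series_mul.
rewrite quoXS (e a) // mulrBl mul1r coefB -scalerAl coefZ coefXM addrC.
rewrite {2}/g -quoE //; case: a @g e => [|a] g e.
  by rewrite quoX0 !mulr0 subr0 addr0.
by rewrite quoXS /= /g -quoE // subrK.
Qed.

Lemma quo_lin_pow (R : comUnitRingType) (u : R) (Q : {poly R}) a :
  Q`_0 = 1 -> quo Q (lin u * Q) a = u ^+ a.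
Proof.
move=> Q0; elim: a => [|a IHa].
  have := quo_lin u Q 0 Q0; rewrite quoXS quoX0 => ->.
  by rewrite -[X in quo X Q]mulr1 quoM // coef1 mulr0 add0r.
have := quo_lin u Q a.+1 Q0; rewrite !quoXS IHa => ->.
by rewrite -[X in quo X Q]mulr1 quoM // coef1 addr0 exprS.
Qed.

(** The row operation between two positions: the recursion above telescopes into
    a sum over the positions that lie between them. *)
Lemma quo_lin_diff (R : comUnitRingType) (u : R) (p Q : {poly R}) a d :
  Q`_0 = 1 ->
  quo ('X * p) (lin u * Q) (a + d) - u ^+ d * quo ('X * p) (lin u * Q) a
    = \sum_(k < d) u ^+ (d - k.+1) * quo p Q (a + k).
Proof.
move=> Q0; elim: d => [|d IHd]; first by rewrite addn0 mul1r subrr big_ord0.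
rewrite addnS quo_lin // big_ord_recr /= subnn mul1r exprS -mulrA addrAC -mulrBr.
rewrite IHd mulr_sumr; congr (_ + _); apply: eq_bigr => k _.
by rewrite mulrA -exprS subSn.
Qed.

(** * Determinants *)

(** Entries indexed by natural numbers, so that minors and shifted rows need no
    casts between ordinals. *)
Definition ndet (R : comPzRingType) (n : nat) (E : nat -> nat -> R) : R :=
  \det (\matrix_(i < n, j < n) E i j).

Lemma eq_ndet (R : comPzRingType) n (E E' : nat -> nat -> R) :
  (forall i j, (i < n)%N -> (j < n)%N -> E i j = E' i j) -> ndet n E = ndet n E'.
Proof. by move=> eE; congr (\det _); apply/matrixP=> i j; rewrite !mxE eE. Qed.

Lemma ndet_last_col (R : comPzRingType) n (E : nat -> nat -> R) :
  (forall i, (i < n)%N -> E i n = 0) -> ndet n.+1 E = ndet n E * E n n.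
Proof.
move=> E0; rewrite /ndet (expand_det_col _ ord_max) big_ord_recr /= big1 ?add0r.
  rewrite mxE mulrC /cofactor /= addnn -mul2n exprM sqrrN !expr1n mul1r.
  congr (\det _ * _); apply/matrixP=> i j; rewrite !mxE.
  by rewrite !lift_max.
by move=> i _; rewrite mxE /= E0 ?mul0r.
Qed.

Lemma ndet_tr (R : comPzRingType) n (E : nat -> nat -> R) :
  ndet n (fun i j => E j i) = ndet n E.
Proof. by rewrite /ndet -det_tr; congr (\det _); apply/matrixP=> i j; rewrite !mxE. Qed.

Lemma ndet_last_row (R : comPzRingType) n (E : nat -> nat -> R) :
  (forall j, (j < n)%N -> E n j = 0) -> ndet n.+1 E = ndet n E * E n n.
Proof. by move=> E0; rewrite -ndet_tr ndet_last_col // ndet_tr. Qed.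

Lemma ndet_add_last_col (R : comPzRingType) n (E : nat -> nat -> R) (u v : nat -> R) :
  ndet n.+1 (fun i j => if (j < n)%N then E i j else u i + v i)
    = ndet n.+1 (fun i j => if (j < n)%N then E i j else u i)
    + ndet n.+1 (fun i j => if (j < n)%N then E i j else v i).
Proof.
rewrite /ndet -!(det_tr (\matrix_(_, _) _)).
rewrite (@determinant_multilinear _ _ _
  (\matrix_(i < n.+1, j < n.+1) if (j < n)%N then E i j else u i)^T
  (\matrix_(i < n.+1, j < n.+1) if (j < n)%N then E i j else v i)^T ord_max 1 1).
- by rewrite !mul1r.
- by apply/rowP=> j; rewrite !mxE /= ltnn !mul1r.
- by apply/matrixP=> i j; rewrite !mxE lift_max ltn_ord.
- by apply/matrixP=> i j; rewrite !mxE lift_max ltn_ord.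
Qed.

Lemma ndet_col_op (R : comPzRingType) n (E : nat -> nat -> R) (u : nat -> R) :
  u n = 1 ->
  ndet n.+1 (fun i j => if (j < n)%N then E i j else \sum_(k < n.+1) u k * E i k)
    = ndet n.+1 E.
Proof.
move=> un; pose V := \matrix_(i < n.+1, j < n.+1)
  (if (j < n)%N then (i == j)%:R else u i : R).
have <- : \det V = 1 -> \det ((\matrix_(i < n.+1, j < n.+1) E i j) *m V) = ndet n.+1 E.
  by move=> V1; rewrite det_mulmx V1 mulr1.
  congr (\det _); apply/matrixP=> i j; rewrite !mxE.
  case: ifP => lt_j.
    rewrite (bigD1 j) //= !mxE lt_j eqxx mulr1 big1 ?addr0 // => k ne.
    by rewrite !mxE lt_j (negPf ne) mulr0.
  by apply: eq_bigr => k _; rewrite !mxE lt_j mulrC.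
rewrite -det_tr det_trig; last first.
  apply/is_trig_mxP => i j lt_ij; rewrite !mxE ifT; last by have := ltn_ord j; lia.
  by case: eqP => // e; move: lt_ij; rewrite e ltnn.
rewrite big1 // => i _; rewrite !mxE eqxx; case: ltnP => // le_n.
by have -> : nat_of_ord i = n by have := ltn_ord i; lia.
Qed.

(** All the subtractions use the original rows, that is, they multiply on the left
    by one unitriangular matrix. *)
Lemma ndet_row_op (R : comPzRingType) n (E : nat -> nat -> R) (v : nat -> R) :
  ndet n.+1 (fun i j => if (i < n)%N then E i j - v i * E i.+1 j else E i j)
    = ndet n.+1 E.
Proof.
pose V := \matrix_(i < n.+1, j < n.+1)
  ((i == j)%:R - v i * (j == i.+1 :> nat)%:R : R).
have V1 : \det V = 1.
  rewrite -det_tr det_trig; last first.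
    apply/is_trig_mxP => i j lt_ij; rewrite !mxE.
    by rewrite -val_eqE /= gtn_eqF // ltn_eqF ?mulr0 ?subrr // ltnW.
   by rewrite big1 // => i _; rewrite !mxE eqxx ltn_eqF ?mulr0 ?subr0.
rewrite -[RHS]mul1r -V1 -det_mulmx.
congr (\det _); apply/matrixP=> i j; rewrite !mxE.
under eq_bigr do rewrite !mxE mulrBl.
rewrite sumrB (bigD1 i) //= eqxx mul1r [X in _ + X - _]big1 ?addr0; last first.
  by move=> k ne; rewrite eq_sym (negPf ne) mul0r.
case: ltnP => [lt_i | le_n].
  have lt_i1 : (i.+1 < n.+1)%N by [].
  rewrite (bigD1 (Ordinal lt_i1)) //= eqxx mulr1 big1 ?addr0 // => k ne.
  by rewrite -val_eqE /= in ne; rewrite (negPf ne) mulr0 mul0r.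
rewrite big1 ?subr0 // => k _; rewrite ltn_eqF ?mulr0 ?mul0r //.
by have := ltn_ord k; lia.
Qed.

(** Multilinearity in all rows at once: each row is a sum over its own range. *)
Lemma ndet_sum_rows (R : comPzRingType) n (T : finType) (P : nat -> pred T)
    (c : nat -> T -> R) (A : nat -> T -> nat -> R) :
  ndet n (fun i j => \sum_(b | P i b) c i b * A i b j)
    = \sum_(f : {ffun 'I_n -> T} | [forall i : 'I_n, P i (f i)])
        (\prod_(i < n) c i (f i)) * \det (\matrix_(i < n, j < n) A i (f i) j).
Proof.
rewrite /ndet {1}/determinant.
under eq_bigr => s _.
  under eq_bigr => i _ do rewrite mxE.
  rewrite bigA_distr_big_dep mulr_sumr.
  over.
rewrite exchange_big; apply: eq_big => [f | f _].
  by rewrite unfold_in; apply: eq_forallb => i.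
rewrite mulr_sumr; apply: eq_bigr => s _.
rewrite big_split /= mulrCA; congr (_ * (_ * _)).
by apply: eq_bigr => i _; rewrite mxE.
Qed.

(** * Removing a linear factor *)

Lemma interlaceE (nu la : seq nat) :
  reflect (forall i, (nth 0 la i.+1 <= nth 0 nu i <= nth 0 la i)%N)
          (interlace nu la).
Proof.
apply: (iffP (interlaceP nu la)) => [H i | H [//|i] _]; last exact: H.
exact: (H i.+1).
Qed.

Lemma interlace_sumn (nu la : seq nat) : interlace nu la -> (sumn nu <= sumn la)%N.
Proof.
move=> /interlaceE H; have {H}: forall i, (nth 0 nu i <= nth 0 la i)%N.
  by move=> i; case/andP: (H i).
elim: nu la => // a nu IH [|b la] H /=.
  have h i : (nth 0 nu i <= nth 0 [::] i)%N.
    by have := H i.+1; rewrite !nth_nil.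
  by have := IH [::] h; have := H 0%N => /=; lia.
by apply: leq_add; [apply: (H 0%N) | apply: IH => i; apply: (H i.+1)].
Qed.

Lemma sorted_geqP (s : seq nat) :
  reflect (forall i, (nth 0 s i.+1 <= nth 0 s i)%N) (sorted geq s).
Proof.
apply: (iffP (sortedP 0%N)) => H i; last by move=> _; apply: H.
by case: (ltnP i.+1 (size s)) => h; [apply: H | rewrite nth_default].
Qed.

Section Rows.
Variable B : nat.

Definition rowseq n (f : {ffun 'I_n -> 'I_B.+1}) : seq nat :=
  [seq val (f i) | i <- enum 'I_n].

Lemma size_rowseq n (f : {ffun 'I_n -> 'I_B.+1}) : size (rowseq f) = n.
Proof. by rewrite size_map size_enum_ord. Qed.

Lemma nth_rowseq n (f : {ffun 'I_n -> 'I_B.+1}) (i : 'I_n) :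
  nth 0%N (rowseq f) i = f i.
Proof. by rewrite (nth_map i) ?size_enum_ord // nth_ord_enum. Qed.

Lemma sumn_rowseq n (f : {ffun 'I_n -> 'I_B.+1}) :
  sumn (rowseq f) = (\sum_i f i)%N.
Proof. by rewrite sumnE big_map big_enum. Qed.

Lemma interlace_rowseq n (f : {ffun 'I_n -> 'I_B.+1}) la : (size la <= n.+1)%N ->
  interlace (rowseq f) la =
  [forall i : 'I_n, (nth 0 la i.+1 <= f i <= nth 0 la i)%N].
Proof.
move=> sz; apply/interlaceE/forallP => H i; first by rewrite -nth_rowseq.
case: (ltnP i n) => h; first by rewrite -[i]/(nat_of_ord (Ordinal h)) nth_rowseq.
by rewrite (nth_default _ (s := la)) ?(nth_default _ (s := rowseq f))
  ?size_rowseq //; lia.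
Qed.

Lemma gpart_rowseq n (f : {ffun 'I_n -> 'I_B.+1}) la :
  interlace (rowseq f) la -> gpart n (rowseq f).
Proof.
move=> /interlaceE H; rewrite /gpart size_rowseq eqxx; apply/sorted_geqP => i.
have /andP[a _] := H i; have /andP[_ b] := H i.+1; exact: leq_trans b a.
Qed.

End Rows.

Lemma sum_ord_interval (V : nmodType) B (lo hi : nat) (F : nat -> V) :
  (hi <= B)%N ->
  \sum_(b < B.+1 | (lo <= b <= hi)%N) F b = \sum_(lo <= b < hi.+1) F b.
Proof.
move=> hB; rewrite big_geq_mkord (big_ord_widen_cond B.+1) //.
Qed.

(** The shift by n - 1 - i makes the positions distinct; the zero partition occupies
    0, ..., n - 1, so that positions are natural numbers. *)
Definition skdet (R : comUnitRingType) n (p : nat -> {poly R}) (Q : {poly R})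
    (la : seq nat) : R :=
  ndet n (fun i j => quo (p j) Q (nth 0%N la i + (n - i.+1))).

(** Dividing Q by (1 - ut) Q gives the geometric sequence u^a, which the row
    operation kills in every row but the last.  The other numerators carry a
    factor t because a partition with one part less sits one position lower. *)
Lemma skdet_strip_last (R : comUnitRingType) n B (u : R) p (Q : {poly R}) la :
  Q`_0 = 1 -> gpart n.+1 la -> (nth 0%N la 0 <= B)%N ->
  skdet n.+1 (fun j => if (j < n)%N then 'X * p j else Q) (lin u * Q) la
    = \sum_(f : {ffun 'I_n -> 'I_B.+1} | interlace (rowseq f) la)
        u ^+ (sumn la - sumn (rowseq f)) * skdet n p Q (rowseq f).
Proof.
move=> Q0 /andP[/eqP sz /sorted_geqP srt] leB.
have leiB i : (nth 0 la i <= B)%N.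
  by elim: i => // i; apply: leq_trans.
rewrite /skdet -(@ndet_row_op _ n _ (fun i => u ^+ (nth 0%N la i - nth 0%N la i.+1).+1)).
(* the distance between consecutive positions is la_i - la_(i+1) + 1 *)
have pos i : (i < n)%N -> (nth 0 la i + (n.+1 - i.+1)
    = nth 0 la i.+1 + (n.+1 - i.+2) + (nth 0 la i - nth 0 la i.+1).+1)%N.
  by move=> lt_i; have := srt i; lia.
rewrite ndet_last_col => [|i lt_i]; last first.
  by rewrite lt_i ltnn !quo_lin_pow // pos // exprD mulrC subrr.
rewrite !ltnn quo_lin_pow // subnn addn0.
rewrite (@eq_ndet _ _ _ (fun i j => \sum_(b < B.+1 |
    (nth 0%N la i.+1 <= b <= nth 0%N la i)%N) u ^+ (nth 0%N la i - b) *
      quo (p j) Q (b + (n - i.+1)))); last first.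
  move=> i j lt_i lt_j; rewrite lt_i lt_j pos // quo_lin_diff //.
  pose F b := u ^+ (nth 0%N la i - b) * quo (p j) Q (b + (n - i.+1)).
  rewrite (@sum_ord_interval _ _ _ _ F) //.
  rewrite -[X in \sum_(X <= _ < _) _]add0n big_addn (subSn (srt i)) big_mkord;
  apply: eq_bigr => k _; rewrite /F.
  by congr (u ^+ _ * quo _ _ _); have := ltn_ord k; lia.
rewrite (ndet_sum_rows n (fun i (b : 'I_B.+1) => nth 0 la i.+1 <= b <= nth 0 la i)%N
  (fun i (b : 'I_B.+1) => u ^+ (nth 0%N la i - b))
  (fun i (b : 'I_B.+1) j => quo (p j) Q (b + (n - i.+1)))).
rewrite mulr_suml; apply: eq_big => [f | f H]; first by rewrite interlace_rowseq ?sz.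
rewrite mulrAC; congr (_ * _); last first.
  by congr (\det _); apply/matrixP=> i j; rewrite !mxE nth_rowseq.
rewrite prodrXr -exprD; congr (_ ^+ _).
rewrite sumn_rowseq sumnE (big_nth 0%N) sz big_mkord big_ord_recr /=.
have le_f : (\sum_(i < n) f i <= \sum_(i < n) nth 0 la i)%N.
  by apply: leq_sum => i _; case/andP: (forallP H i).
rewrite sumnB => [|i _]; last by case/andP: (forallP H i).
by rewrite -addnBAC.
Qed.

(** Appending a part 0 to la and a geometric column does not change the
    determinant, since the new last row is (0, ..., 0, 1); this reduces to the
    previous lemma. *)
Lemma skdet_strip (R : comUnitRingType) n B (u : R) p (Q : {poly R}) la :
  Q`_0 = 1 -> gpart n la -> (nth 0%N la 0 <= B)%N ->
  skdet n p (lin u * Q) la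
    = \sum_(f : {ffun 'I_n -> 'I_B.+1} | interlace (rowseq f) la)
        u ^+ (sumn la - sumn (rowseq f)) * skdet n p Q (rowseq f).
Proof.
move=> Q0 /andP[/eqP sz srt] leB.
have nth0 i : nth 0%N (rcons la 0%N) i = nth 0%N la i.
  by rewrite nth_rcons; case: ltngtP => // h; rewrite ?nth_default // ?h // ltnW.
have -> : skdet n p (lin u * Q) la =
    skdet n.+1 (fun j => if (j < n)%N then 'X * p j else Q) (lin u * Q) (rcons la 0%N).
  rewrite /skdet ndet_last_row => [|j lt_j]; last first.
    by rewrite nth0 nth_default ?sz // lt_j subnn quoX0.
  rewrite ltnn nth0 nth_default ?sz // subnn quo_lin_pow // mulr1.
  apply: eq_ndet => i j lt_i lt_j; rewrite lt_j nth0 subSS.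
  by rewrite -(subnSK lt_i) addnS quoXS.
rewrite (@skdet_strip_last _ _ B) ?nth0 //; last first.
  rewrite /gpart size_rcons sz eqxx; apply/sorted_geqP => i; rewrite !nth0.
  by move/sorted_geqP: srt.
apply: eq_big => [f | f _]; last by rewrite sumn_rcons addn0.
by rewrite !interlace_rowseq ?size_rcons ?sz //; apply: eq_forallb => i; rewrite !nth0.
Qed.

(** * The columns of the two determinants *)

(** Palindromic of degree at most 2N, centered at t^N. *)
Definition palin (R : nzRingType) N (q : {poly R}) : Prop :=
  (forall s t, (s + t = 2 * N)%N -> q`_s = q`_t) /\
  (forall s, (2 * N < s)%N -> q`_s = 0).

Lemma coef_mul_quad (R : comNzRingType) (q : {poly R}) (w : R) s :
  (q * (1 - w *: 'X + 'X^2))`_s =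
    q`_s - w * (if s is s'.+1 then q`_s' else 0)
    + (if s is s'.+2 then q`_s' else 0).
Proof.
rewrite mulrDr mulrBr mulr1 -scalerAr !coefD coefN coefZ coefMX coefMXn.
by case: s => [|[|s]] //=; rewrite subn2.
Qed.

Lemma palin_quad (R : comNzRingType) N (q : {poly R}) (w : R) :
  palin N q -> palin N.+1 (q * (1 - w *: 'X + 'X^2)).
Proof.
case=> q_sym q_big; split=> [s t est | s lt_s]; last first.
  rewrite coef_mul_quad; case: s lt_s => [|[|s]] lt_s; try lia.
  by rewrite !q_big ?mulr0 ?subr0 ?addr0 //; lia.
rewrite !coef_mul_quad.
case: s est => [|[|s]]; case: t => [|[|t]] est; try lia.
- have -> : q`_t.+2 = 0 by apply: q_big; lia.
  have -> : q`_t.+1 = 0 by apply: q_big; lia.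
  by rewrite (q_sym 0%N t) ?mulr0 ?subr0 ?addr0 ?add0r //; lia.
- by [].
- have -> : q`_t.+2 = 0 by apply: q_big; lia.
  rewrite (q_sym 1%N t) ?(q_sym 0%N t.+1) ?addr0 ?sub0r; [|lia..].
  by rewrite addrC.
- have -> : q`_s.+2 = 0 by apply: q_big; lia.
  have -> : q`_s.+1 = 0 by apply: q_big; lia.
  by rewrite (q_sym 0%N s) ?mulr0 ?subr0 ?addr0 ?add0r //; lia.
- have -> : q`_s.+2 = 0 by apply: q_big; lia.
  rewrite (q_sym 1%N s) ?(q_sym 0%N s.+1) ?addr0 ?sub0r; [|lia..].
  by rewrite addrC.
rewrite (q_sym s.+1 t.+1) ?(q_sym s.+2 t) ?(q_sym s t.+2); [|lia..].
by rewrite addrAC [RHS]addrAC [q`_t + _]addrC.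
Qed.

Definition symP (R : comUnitRingType) (x : nat -> R) N : {poly R} :=
  \prod_(i < N) (lin (x i) * lin (x i)^-1).

Lemma symPS (R : comUnitRingType) (x : nat -> R) N :
  symP x N.+1 = lin (x N)^-1 * (lin (x N) * symP x N).
Proof. by rewrite /symP big_ord_recr /= mulrC [lin (x N) * _]mulrC -mulrA. Qed.

Lemma coef0_symP (R : comUnitRingType) (x : nat -> R) N : (symP x N)`_0 = 1.
Proof.
elim: N => [|N IH]; first by rewrite /symP big_ord0 coef1.
by rewrite symPS !coef0_lin.
Qed.

Lemma palin_symP (R : comUnitRingType) (x : nat -> R) N :
  (forall i, x i \is a GRing.unit) -> palin N (symP x N).
Proof.
move=> xU; elim: N => [|N IH].
  rewrite /symP big_ord0; split=> [s t | s lt_s]; last by rewrite coef1; case: s lt_s.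
  by move/eqP; rewrite addn_eq0 => /andP[/eqP-> /eqP->].
have -> : symP x N.+1 = symP x N * (1 - ((x N)^-1 + x N) *: 'X + 'X^2).
  rewrite symPS mulrA mulrC; congr (_ * _).
  rewrite /lin -!mul_polyC polyCD.
  have /(congr1 (@polyC R)) := mulVr (xU N); rewrite polyCM polyC1 => e.
  by rewrite -['X^2]mul1r -[X in _ = _ + X * _]e; ring.
exact: palin_quad.
Qed.

Lemma sum_centered (V : nmodType) N (F : nat -> V) :
  \sum_(s < (2 * N).+1) F s = F N + \sum_(k < N) (F (N - k.+1)%N + F (N + k.+1)%N).
Proof.
rewrite -(big_mkord xpredT F) (@big_cat_nat _ _ _ N) //=; last by lia.
rewrite [X in _ + X]big_ltn; last by lia.
rewrite addrCA; congr (_ + _).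
rewrite big_split /= big_nat_rev /= add0n big_mkord; congr (_ + _).
rewrite -[X in \sum_(X <= _ < _) _]add0n big_addn big_mkord.
have -> : ((2 * N).+1 - N.+1 = N)%N by lia.
by apply: eq_bigr => i _; rewrite addnC addSn addnS.
Qed.

Lemma poly_centered (R : comNzRingType) N (q : {poly R}) :
  (forall s, (2 * N < s)%N -> q`_s = 0) ->
  q = q`_N *: 'X^N
    + \sum_(k < N) (q`_(N - k.+1) *: 'X^(N - k.+1) + q`_(N + k.+1) *: 'X^(N + k.+1)).
Proof.
move=> q_big; rewrite -(sum_centered N (fun s => q`_s *: 'X^s)) -poly_def.
apply/polyP=> s; rewrite coef_poly ltnS; case: leqP => // lt_s; exact: q_big.
Qed.

(** The numerators of the columns, numbered from 0.  The column number l is the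
    central one: nth returns 0 there for a mu with l entries. *)
Definition spcol (R : comUnitRingType) l (mu : seq nat) N (j : nat) : {poly R} :=
  if (j <= l)%N then 'X^(nth 0%N mu j + (l + N - j.+1))
  else 'X^(l + N - j.+1) + 'X^(N + j - l.+1).

Definition ocol (R : comUnitRingType) l (mu : seq nat) N (j : nat) : {poly R} :=
  if (j < l)%N then 'X^(nth 0%N mu j + (l + N - j.+1))
  else 'X^(l + N - j.+1) - 'X^(N + j.+1 - l).

Lemma spcolS (R : comUnitRingType) l mu N j : (j < l + N)%N ->
  spcol R l mu N.+1 j = 'X * spcol R l mu N j.
Proof.
move=> lt_j; rewrite /spcol; case: leqP => h; rewrite ?mulrDr -!exprS.
  by congr 'X^_; lia.
by congr ('X^_ + 'X^_); lia.
Qed.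

Lemma ocolS (R : comUnitRingType) l mu N j : (j < l + N)%N ->
  ocol R l mu N.+1 j = 'X * ocol R l mu N j.
Proof.
move=> lt_j; rewrite /ocol; case: ltnP => h; rewrite ?mulrBr -!exprS.
  by congr 'X^_; lia.
by congr ('X^_ - 'X^_); lia.
Qed.

(** Grouping the terms of q of equal distance to the center gives the symplectic
    numerators; the last of them receives the coefficient q_0. *)
Lemma palin_spcol (R : comUnitRingType) l mu N (q : {poly R}) :
  (size mu <= l)%N -> palin N q ->
  q = \sum_(j < (l + N).+1)
        (if (j < l)%N then 0 else q`_(l + N - j)) *: spcol R l mu N.+1 j.
Proof.
move=> sz [q_sym q_big]; rewrite [LHS](poly_centered q_big) -addnS big_split_ord /=.
rewrite [X in _ = X + _]big1 ?add0r => [|i _]; last by rewrite ltn_ord scale0r.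
rewrite big_ord_recl /= addn0 ltnn /spcol leqnn (nth_default _ sz) add0n.
congr (_ + _); first by congr (q`_ _ *: 'X^ _); lia.
apply: eq_bigr => k _; rewrite /bump /= add1n.
rewrite !ifF; [|lia..].
rewrite scalerDr; congr (_ *: 'X^_ + _ *: 'X^_); try lia.
  by congr (q`_ _); lia.
by apply: q_sym; have := ltn_ord k; lia.
Qed.

(** The product (1 - t^2) q is antipalindromic, centered at t^(N+1).  Its middle
    coefficient is q_(N+1) - q_(N-1) = 0; antisymmetry alone would not give this in
    characteristic 2. *)
Lemma palin_ocol (R : comUnitRingType) l mu N (q : {poly R}) :
  palin N q ->
  (1 - 'X^2) * q = \sum_(j < (l + N).+1)
     (if (j < l)%N then 0 else ((1 - 'X^2) * q)`_(l + N - j)) *: ocol R l mu N.+1 j.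
Proof.
move=> [q_sym q_big]; set r := (1 - 'X^2) * q.
have rE s : r`_s = q`_s - (if s is s'.+2 then q`_s' else 0).
  rewrite /r mulrBl mul1r coefB coefXnM.
  by case: s => [|[|s]] //=; rewrite subn2.
have r_big s : (2 * N.+1 < s)%N -> r`_s = 0.
  case: s => [|[|s]] h; try lia.
  by rewrite rE !q_big ?subr0 //; lia.
have r_sym s t : (s + t = 2 * N.+1)%N -> (s < N.+1)%N -> r`_t = - r`_s.
  move=> est lt_s; rewrite !rE; case: t est => [|[|t]] est; try lia.
  rewrite opprB; congr (_ - _); last by apply: q_sym; lia.
  case: s est lt_s => [|[|s]] est lt_s; try by apply: q_big; lia.
  by apply: q_sym; lia.
have r_mid : r`_N.+1 = 0.
  rewrite rE; case: N q_sym q_big {r rE r_big r_sym} => [|N] q_sym q_big.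
    by rewrite q_big // subr0.
  by rewrite (q_sym N.+2 N) ?subrr //; lia.
rewrite [LHS](poly_centered r_big) -addnS big_split_ord /=.
rewrite r_mid scale0r add0r.
rewrite [X in _ = X + _]big1 ?add0r => [|i _]; last by rewrite ltn_ord scale0r.
apply: eq_bigr => k _; rewrite /ocol ltnNge leq_addr /=.
rewrite scalerBr (r_sym (N.+1 - k.+1)%N (N.+1 + k.+1)%N) ?scaleNr; [|have := ltn_ord k; lia..].
by congr (r`_ _ *: 'X^_ - r`_ _ *: 'X^_); lia.
Qed.

(** The last numerator may be replaced by any combination that contains it with
    coefficient 1. *)
Lemma skdet_col_op (R : comUnitRingType) n (p : nat -> {poly R}) Q q la (u : nat -> R) :
  u n = 1 -> q = \sum_(j < n.+1) u j *: p j ->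
  skdet n.+1 (fun j => if (j < n)%N then p j else q) Q la = skdet n.+1 p Q la.
Proof.
move=> un ->; rewrite /skdet -[RHS](ndet_col_op _ un); apply: eq_ndet => i j _ _.
by case: ifP => // _; rewrite quo_sum.
Qed.

(** * Symplectic branching *)

(** The rows are listed backwards with respect to their order in a chain. *)
Definition wt2 (R : unitRingType) (y : R) (la c b : seq nat) : R :=
  y ^ (2 * (sumn c)%:Z - (sumn la)%:Z - (sumn b)%:Z).

Lemma wt2E (R : comUnitRingType) (y : R) la c b : y \is a GRing.unit ->
  (sumn b <= sumn c)%N -> (sumn c <= sumn la)%N ->
  y^-1 ^+ (sumn la - sumn c) * y ^+ (sumn c - sumn b) = wt2 y la c b.
Proof.
move=> yU le1 le2; rewrite /wt2 !exprnP exprz_inv -exprzDr //.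
by congr (y ^ _); lia.
Qed.

(** The symplectic branching rule: the last column is replaced by P_N, then the
    factor 1 - t / y is removed at constant length and 1 - y t with the loss of
    one part. *)
Lemma skdet_spcolS (R : comUnitRingType) l mu (x : nat -> R) N B la :
  (forall i, x i \is a GRing.unit) -> (size mu <= l)%N ->
  gpart (l + N).+1 la -> (nth 0%N la 0 <= B)%N ->
  skdet (l + N).+1 (spcol R l mu N.+1) (symP x N.+1) la
    = \sum_(c : {ffun 'I_(l + N).+1 -> 'I_B.+1} | interlace (rowseq c) la)
      \sum_(b : {ffun 'I_(l + N) -> 'I_B.+1} | interlace (rowseq b) (rowseq c))
        wt2 (x N) la (rowseq c) (rowseq b)
        * skdet (l + N) (spcol R l mu N) (symP x N) (rowseq b).
Proof.
move=> xU sz gla leB; have Q0 := coef0_symP x N.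
have top : (if (l + N < l)%N then 0 else (symP x N)`_(l + N - (l + N))) = 1.
  by rewrite ltnNge leq_addr subnn.
rewrite -(@skdet_col_op _ _ _ _ _ _
  (fun j => if (j < l)%N then 0 else (symP x N)`_(l + N - j))
  top (palin_spcol sz (palin_symP N xU))).
rewrite symPS (@skdet_strip _ _ B) ?coef0_lin //; apply: eq_bigr => c c_la.
set p := (fun j => _).
have -> : skdet (l + N).+1 p (lin (x N) * symP x N) (rowseq c)
  = skdet (l + N).+1 (fun j => if (j < l + N)%N then 'X * spcol R l mu N j
      else symP x N) (lin (x N) * symP x N) (rowseq c).
  by apply: eq_ndet => i j _ _; rewrite /p; case: ifP => // h; rewrite spcolS.
have c0 : (nth 0 (rowseq c) 0 <= B)%N.
  by rewrite -[X in nth _ _ X]/(nat_of_ord (@ord0 (l + N))) nth_rowseq -ltnS.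
rewrite (@skdet_strip_last _ _ B) ?(gpart_rowseq c_la) // mulr_sumr.
apply: eq_bigr => b b_c; rewrite mulrA wt2E //; exact: interlace_sumn.
Qed.

(** The two removals in the other order: first the one that shortens la. *)
Lemma skdet_strip2 (R : comUnitRingType) n B (y : R) p (Q : {poly R}) la :
  y \is a GRing.unit -> Q`_0 = 1 -> gpart n.+1 la -> (nth 0%N la 0 <= B)%N ->
  skdet n.+1 (fun j => if (j < n)%N then 'X * p j else lin y * Q)
      (lin y^-1 * (lin y * Q)) la
    = \sum_(c : {ffun 'I_n -> 'I_B.+1} | interlace (rowseq c) la)
      \sum_(b : {ffun 'I_n -> 'I_B.+1} | interlace (rowseq b) (rowseq c))
        wt2 y la (rowseq c) (rowseq b) * skdet n p Q (rowseq b).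
Proof.
move=> yU Q0 gla leB.
rewrite (@skdet_strip_last _ _ B) ?coef0_lin //; apply: eq_bigr => c c_la.
have c0 : (nth 0 (rowseq c) 0 <= B)%N.
  case: n c {p gla c_la} => [|n] c; first by rewrite nth_default ?size_rowseq.
  by rewrite -[X in nth _ _ X]/(nat_of_ord (@ord0 n)) nth_rowseq -ltnS.
rewrite (@skdet_strip _ _ B) ?(gpart_rowseq c_la) // mulr_sumr.
apply: eq_bigr => b b_c; rewrite mulrA wt2E //; exact: interlace_sumn.
Qed.

(** * Orthogonal branching *)

(** By 1 - t^2 = A + B - A B, the last column is y^a + y^(-a) at every position
    a > 0 and 1 at a = 0.  Only the last row can be at position 0, and then it is
    (0, ..., 0, 1), so that a single geometric column gives the same value. *)
Lemma skdet_ocolS_sym (R : comUnitRingType) l mu (x : nat -> R) N B la :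
  (forall i, x i \is a GRing.unit) ->
  gpart (l + N).+1 la -> (nth 0%N la 0 <= B)%N ->
  let S y :=
    \sum_(c : {ffun 'I_(l + N) -> 'I_B.+1} | interlace (rowseq c) la)
      \sum_(b : {ffun 'I_(l + N) -> 'I_B.+1} | interlace (rowseq b) (rowseq c))
        wt2 y la (rowseq c) (rowseq b)
        * skdet (l + N) (ocol R l mu N) (symP x N) (rowseq b) in
  skdet (l + N).+1 (ocol R l mu N.+1) (symP x N.+1) la
    = S (x N) + (if (0 < nth 0 la (l + N))%N then S (x N)^-1 else 0).
Proof.
move=> xU gla leB S; have Q0 := coef0_symP x N.
set n := (l + N)%N; set y := x N; set Q := symP x N.
have yU : y \is a GRing.unit by exact: xU.
set W := symP x N.+1.
have WE1 : W = lin y^-1 * (lin y * Q) by exact: symPS.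
have WE2 : W = lin y * (lin y^-1 * Q) by rewrite WE1 mulrCA.
have W0 : W`_0 = 1 by exact: coef0_symP.
pose u j : R := if (j < l)%N then 0 else ((1 - 'X^2) * Q)`_(n - j).
have top : u n = 1.
  rewrite /u ltnNge leq_addr subnn /= coef0M Q0 coefB coef1 coefXn.
  by rewrite subr0 mulr1.
rewrite -(@skdet_col_op _ _ _ _ _ _ u top (palin_ocol l mu (palin_symP N xU))) -/n -/W -/Q.
pose p j := 'X * ocol R l mu N j.
have to_p q : skdet n.+1 (fun j => if (j < n)%N then ocol R l mu N.+1 j else q) W la
  = skdet n.+1 (fun j => if (j < n)%N then p j else q) W la.
  by apply: eq_ndet => i j _ _; case: ifP => // h; rewrite ocolS.
rewrite to_p.
have SE1 : S y = skdet n.+1 (fun j => if (j < n)%N then p j else lin y * Q) W la.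
  by rewrite WE1 (@skdet_strip2 _ _ B).
have SE2 : S y^-1 = skdet n.+1 (fun j => if (j < n)%N then p j else lin y^-1 * Q) W la.
  have y'U : y^-1 \is a GRing.unit by rewrite unitrV.
  by have := skdet_strip2 (ocol R l mu N) y'U Q0 gla leB; rewrite invrK -WE2 => ->.
rewrite SE1 SE2 {S SE1 SE2}.
(* 1 - t^2 = A + B - A B, where W = A B Q *)
have XQ : (1 - 'X^2) * Q = lin y * Q + (lin y^-1 * Q - W).
  rewrite WE1 mulrA /lin -!mul_polyC.
  have /(congr1 (@polyC R)) := mulVr yU; rewrite polyCM polyC1 => e.
  by rewrite -['X^2]mul1r -[X in _ - X * _]e; ring.
have quoW a : quo ((1 - 'X^2) * Q) W a =
    quo (lin y * Q) W a + (quo (lin y^-1 * Q) W a - (a == 0%N)%:R).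
  rewrite XQ quoD quoB; congr (_ + (_ - _)).
  by rewrite -[X in quo X]mulr1 quoM // coef1.
pose E i j := quo (p j) W (nth 0%N la i + (n.+1 - i.+1)).
have splitE q : skdet n.+1 (fun j => if (j < n)%N then p j else q) W la
  = ndet n.+1 (fun i j => if (j < n)%N then E i j
                          else quo q W (nth 0%N la i + (n.+1 - i.+1))).
  by apply: eq_ndet => i j _ _; case: ifP.
rewrite !splitE; case: ltnP => [la_gt0 | la0].
  rewrite -ndet_add_last_col; apply: eq_ndet => i j lt_i _; case: ifP => // _.
  rewrite quoW [(_ == 0)%N]gtn_eqF ?subr0 //.
  by move: lt_i; rewrite ltnS leq_eqVlt => /predU1P[->|]; lia.
rewrite leqn0 in la0.
have last_row q : ndet n.+1 (fun i j => if (j < n)%N then E i j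
    else quo q W (nth 0%N la i + (n.+1 - i.+1))) = ndet n E * quo q W 0.
  rewrite ndet_last_row => [|j lt_j]; last by rewrite lt_j /E (eqP la0) subnn quoX0.
  rewrite ltnn (eqP la0) subnn; congr (_ * _).
  by apply: eq_ndet => i j _ lt_j; rewrite lt_j.
have q1 : quo (lin y^-1 * Q) W 0 = 1 by rewrite WE2 quo_lin_pow ?coef0_lin.
by rewrite !last_row quoW q1 subrr !addr0.
Qed.

Definition ffrcons (T : Type) n (f : {ffun 'I_n -> T}) (a : T) : {ffun 'I_n.+1 -> T} :=
  [ffun i => if unlift ord_max i is Some j then f j else a].

Lemma sum_ffrcons (V : nmodType) (T : finType) n (G : {ffun 'I_n.+1 -> T} -> V) :
  \sum_f G f = \sum_(f : {ffun 'I_n -> T}) \sum_a G (ffrcons f a).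
Proof.
rewrite pair_big /= (reindex (fun fa => ffrcons fa.1 fa.2)) //=.
exists (fun g : {ffun 'I_n.+1 -> T} => ([ffun j => g (lift ord_max j)], g ord_max)).
  move=> [f a] _ /=; congr (_, _); last by rewrite ffunE unlift_none.
  by apply/ffunP=> j; rewrite !ffunE liftK.
move=> g _; apply/ffunP=> i; rewrite ffunE.
by case: unliftP => [j|] -> /=; rewrite ?ffunE.
Qed.

Lemma rowseq_ffrcons B n (f : {ffun 'I_n -> 'I_B.+1}) a :
  rowseq (ffrcons f a) = rcons (rowseq f) a.
Proof.
apply: (@eq_from_nth _ 0%N) => [|i]; first by rewrite size_rcons !size_rowseq.
rewrite size_rowseq => lt_i; rewrite nth_rcons size_rowseq.
rewrite -[i in LHS]/(nat_of_ord (Ordinal lt_i)) nth_rowseq ffunE.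
case: unliftP => [j|] /(congr1 (@nat_of_ord _)) /=.
  by rewrite /bump leqNgt ltn_ord => ->; rewrite ltn_ord nth_rowseq.
by move=> ->; rewrite ltnn eqxx.
Qed.

Lemma interlace_rcons_r b c s : size b = size c -> (0 < size b)%N ->
  interlace b (rcons c s) = interlace b c && (s <= nth 0 b (size b).-1)%N.
Proof.
move=> sz sz0; apply/interlaceE/andP => [H | [/interlaceE H le_s] i]; last first.
  have := H i; rewrite !nth_rcons -sz; case: (ltngtP i.+1 (size b)) => [lt_i|gt_i|ei].
  - by [].
  - by rewrite (nth_default _ (s := b)).
  by rewrite -ei /= in le_s *; rewrite le_s => /andP[_].
split; last first.
  have /andP[] := H (size b).-1; rewrite prednK // nth_rcons -sz ltnn eqxx.
  by [].
apply/interlaceE => i; have := H i; rewrite !nth_rcons -sz.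
case: (ltngtP i.+1 (size b)) => [lt_i|gt_i|ei].
- by [].
- by rewrite (nth_default _ (s := b)) // (nth_default _ (s := c)) // -sz ltnW.
by rewrite (@nth_default _ _ c i.+1) -?sz ?ei // => /andP[_ ->].
Qed.

Lemma interlace_rcons_l c s la : size la = (size c).+1 ->
  interlace (rcons c s) la = interlace c la && (s <= nth 0 la (size c))%N.
Proof.
move=> sz; apply/interlaceE/andP => [H | [/interlaceE H le_s] i]; last first.
  have := H i; rewrite !nth_rcons; case: ltngtP => // ei.
  - by rewrite (nth_default _ (s := c)) // ltnW.
  by rewrite ei le_s nth_default ?sz.
split; last by have := H (size c); rewrite nth_rcons ltnn eqxx => /andP[].
apply/interlaceE => i; have := H i; rewrite nth_rcons; case: ltngtP => // h _.
- by rewrite !nth_default ?sz // ltnW.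
by rewrite h (nth_default _ (s := c)) // nth_default ?sz.
Qed.

(** The reflection f_i -> lo_i + hi_i - f_i is an involution of the box. *)
Lemma sum_box_reflect (V : nmodType) n B (lo hi : nat -> nat) (G : nat -> V) :
  (forall i, (hi i <= B)%N) ->
  \sum_(f : {ffun 'I_n -> 'I_B.+1} | [forall i : 'I_n, (lo i <= f i <= hi i)%N])
      G (\sum_i f i)%N
  = \sum_(f : {ffun 'I_n -> 'I_B.+1} | [forall i : 'I_n, (lo i <= f i <= hi i)%N])
      G (\sum_(i < n) (lo i + hi i) - \sum_i f i)%N.
Proof.
move=> hiB.
pose box (f : {ffun 'I_n -> 'I_B.+1}) := [forall i : 'I_n, (lo i <= f i <= hi i)%N].
pose h (f : {ffun 'I_n -> 'I_B.+1}) : {ffun 'I_n -> 'I_B.+1} :=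
  [ffun i : 'I_n => inord (lo i + hi i - f i)].
have hE f i : box f -> (h f i : nat) = (lo i + hi i - f i)%N.
  by move=> /forallP/(_ i) H; rewrite ffunE inordK //; have := hiB i; lia.
have box_h f : box f -> box (h f).
  by move=> bf; apply/forallP => i; rewrite hE //; have := forallP bf i; lia.
have hK f : box f -> h (h f) = f.
  move=> bf; apply/ffunP => i; apply: val_inj => /=.
  by rewrite hE ?box_h // hE //; have := forallP bf i; lia.
rewrite (reindex_onto h h) => [|f]; last exact: hK.
apply: eq_big => [f | f /andP[bhf /eqP hhf]].
  by apply/andP/idP => [[bhf /eqP <-]|bf]; [exact: box_h | rewrite -/(box _) box_h ?hK].
have bf : box f by rewrite -hhf; exact: box_h.
congr (G _); rewrite -sumnB => [|i _]; last by have := forallP bf i; lia.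
by apply: eq_bigr => i _; rewrite hE.
Qed.

(** For fixed la and b, the parts of c in the chain b, c, la vary independently,
    part i between box_lo and box_hi. *)
Definition box_lo (la b : seq nat) i := maxn (nth 0%N la i.+1) (nth 0%N b i).
Definition box_hi (la b : seq nat) i :=
  if i is k.+1 then minn (nth 0%N la i) (nth 0%N b k) else nth 0%N la 0.

Lemma interlace_box B n (c : {ffun 'I_n -> 'I_B.+1}) la b :
  size la = n.+1 -> size b = n ->
  interlace (rowseq c) la && interlace b (rowseq c)
    = [forall i : 'I_n, (box_lo la b i <= c i <= box_hi la b i)%N].
Proof.
move=> sz_la sz_b; rewrite interlace_rowseq ?sz_la //.
apply/andP/forallP => [[/forallP Hla /interlaceE Hb] i | H].
  rewrite /box_lo /box_hi geq_max -(nth_rowseq c i).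
  have := Hla i; have := Hb i; rewrite -(nth_rowseq c i).
  case: (nat_of_ord i) => [|k] /andP[_ ->] /andP[-> h] //=.
  by rewrite leq_min h; case/andP: (Hb k) => ->.
split.
  apply/forallP => i; have := H i; rewrite /box_lo /box_hi geq_max.
  case: (nat_of_ord i) => [|k] /andP[/andP[-> _]] //=.
  by rewrite leq_min => /andP[->].
apply/interlaceE => i; apply/andP; split; last first.
  case: (ltnP i n) => h; last by rewrite nth_default ?sz_b.
  have := H (Ordinal h); rewrite -nth_rowseq /= /box_lo geq_max.
  by move=> /andP[/andP[_ ->]].
case: (ltnP i.+1 n) => h; last by rewrite nth_default ?size_rowseq.
have := H (Ordinal h); rewrite -nth_rowseq /= /box_hi leq_min.
by move=> /andP[_ /andP[_ ->]].
Qed.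

(** The bounds of the box pair up: max (a_(i+1), b_i) from part i and
    min (a_(i+1), b_i) from part i + 1 add up to a_(i+1) + b_i, and only the last
    minimum is missing. *)
Lemma sum_box (a b : nat -> nat) m :
  (\sum_(i < m.+1) (maxn (a i.+1) (b i)
      + (if nat_of_ord i is k.+1 then minn (a i) (b k) else a 0%N))
    + minn (a m.+1) (b m) = \sum_(i < m.+2) a i + \sum_(i < m.+1) b i)%N.
Proof.
elim: m => [|m IH]; first by rewrite !big_ord_recr !big_ord0 /=; lia.
rewrite big_ord_recr /= [X in _ = (X + _)%N]big_ord_recr /=.
rewrite [X in _ = (_ + X)%N]big_ord_recr /=.
move: IH; move: (bigop _ _ _) (bigop _ _ _) (bigop _ _ _) => S1 S2 S3; lia.
Qed.

Lemma sumn_ord s : sumn s = (\sum_(i < size s) nth 0 s i)%N.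
Proof. by rewrite sumnE (big_nth 0%N) big_mkord. Qed.

(** Reflecting the box sends |c| to |la| + |b| - m - |c| for m the missing minimum,
    so inverting y amounts to appending the part m to c. *)
Lemma sum_wt2_reflect (R : comUnitRingType) B n (y : R) la b :
  y \is a GRing.unit -> (forall i, (nth 0 la i <= B)%N) ->
  size la = n.+2 -> size b = n.+1 ->
  let box (c : {ffun 'I_n.+1 -> 'I_B.+1}) :=
    interlace (rowseq c) la && interlace b (rowseq c) in
  \sum_(c | box c) wt2 y^-1 la (rowseq c) b
    = \sum_(c | box c)
        wt2 y la (rcons (rowseq c) (minn (nth 0 la n.+1) (nth 0 b n)))%N b.
Proof.
move=> yU leB sz_la sz_b /=; set m := minn _ _.
rewrite !(eq_bigl _ _ (fun c => @interlace_box B _ c _ _ sz_la sz_b)).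
pose S := ((sumn la)%:Z + (sumn b)%:Z).
pose G t := y ^ (S - 2 * t%:Z).
have hiB i : (box_hi la b i <= B)%N.
  by case: i => [|i] //=; rewrite geq_min leB.
have sumE : (\sum_(i < n.+1) (box_lo la b i + box_hi la b i) + m
    = sumn la + sumn b)%N.
  by rewrite !sumn_ord sz_la sz_b -(sum_box (nth 0%N la) (nth 0%N b) n).
rewrite [LHS](eq_bigr (fun c : {ffun 'I_n.+1 -> 'I_B.+1} => G (\sum_i c i)%N)).
  rewrite (@sum_box_reflect _ _ _ _ _ G hiB); apply: eq_bigr => c /forallP H.
  rewrite /G /wt2 sumn_rcons sumn_rowseq; congr (y ^ _).
  have : (\sum_i c i <= \sum_(i < n.+1) (box_lo la b i + box_hi la b i))%N.
    by apply: leq_sum => i _; case/andP: (H i) => _ h; apply: leq_trans h (leq_addl _ _).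
  move: sumE; rewrite /S; move: (bigop _ _ _) (bigop _ _ _) => X Y.
  lia.
move=> c _; rewrite /wt2 /G sumn_rowseq exprz_inv; congr (y ^ _).
by rewrite /S; lia.
Qed.

(** Here b has k entries and la has k + 1, so that their last entries are the ones
    compared with 0. *)
Definition o_fac (la b : seq nat) k : nat :=
  (1 + (0 < nth 0 la k) * (nth 0 b k.-1 == 0))%N.

(** The last part of c is 0 or the minimum m.  If m > 0 these are two patterns of
    multiplicity 1; if m = 0 they coincide, and the pattern is counted twice
    exactly when the last part of la is positive. *)
Lemma sum_o_steps (R : comUnitRingType) B n (y : R) la b :
  y \is a GRing.unit -> (forall i, (nth 0 la i <= B)%N) ->
  size la = n.+2 -> size b = n.+1 ->
  \sum_(c : {ffun 'I_n.+2 -> 'I_B.+1} |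
      [&& interlace (rowseq c) la, interlace b (rowseq c)
        & (nth 0 (rowseq c) n.+1 \in [:: 0; minn (nth 0 la n.+1) (nth 0 b n)])%N])
    (o_fac la b n.+1)%:R * wt2 y la (rowseq c) b
  = \sum_(c : {ffun 'I_n.+1 -> 'I_B.+1} |
       interlace (rowseq c) la && interlace b (rowseq c)) wt2 y la (rowseq c) b
  + (if (0 < nth 0 la n.+1)%N then
      \sum_(c : {ffun 'I_n.+1 -> 'I_B.+1} |
       interlace (rowseq c) la && interlace b (rowseq c)) wt2 y^-1 la (rowseq c) b
     else 0).
Proof.
move=> yU leB sz_la sz_b; rewrite sum_wt2_reflect //.
set m := minn _ _; set fac := (o_fac la b n.+1)%:R.
rewrite big_mkcond sum_ffrcons /=.
have leB' : (m < B.+1)%N by rewrite ltnS geq_min leB.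
transitivity (\sum_(c : {ffun 'I_n.+1 -> 'I_B.+1} |
       interlace (rowseq c) la && interlace b (rowseq c))
   \sum_(s < B.+1 | (s : nat) \in [:: 0; m]%N) fac * wt2 y la (rcons (rowseq c) s) b).
  rewrite [RHS]big_mkcond; apply: eq_bigr => c _; rewrite -big_mkcond /=.
  under eq_bigr do rewrite rowseq_ffrcons.
  set A := (interlace (rowseq c) la && _).
  have -> : (if A then \sum_(s < B.+1 | (s : nat) \in [:: 0; m]%N)
        fac * wt2 y la (rcons (rowseq c) s) b else 0)
    = \sum_(s < B.+1 | A && ((s : nat) \in [:: 0; m]%N))
        fac * wt2 y la (rcons (rowseq c) s) b.
    by case: (A) => //; rewrite big_pred0.
  apply: eq_bigl => s; rewrite rowseq_ffrcons /A.
  rewrite interlace_rcons_l ?interlace_rcons_r ?size_rowseq ?sz_b //=.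
  rewrite nth_rcons size_rowseq ltnn eqxx !inE.
  have [->|_] /= := eqVneq (s : nat) 0%N; first by rewrite !andbT.
  case: eqP => [->|_]; last by rewrite !andbF.
  by rewrite geq_minl geq_minr !andbT.
case: ltnP => [la_gt0 | la_0]; last first.
  have m0 : m = 0%N by rewrite /m; lia.
  have -> : fac = 1 by rewrite /fac /o_fac ltnNge la_0.
  rewrite addr0; apply: eq_bigr => c _.
  rewrite (big_pred1 (ord0 : 'I_B.+1)) => [|s]; last by rewrite !inE m0 orbb.
  by rewrite mul1r /wt2 sumn_rcons addn0.
rewrite -big_split; apply: eq_bigr => c _ /=.
have [b0 | b_neq0] := eqVneq (nth 0%N b n) 0%N.
  have m0 : m = 0%N by rewrite /m b0 minn0.
  have -> : fac = 2 by rewrite /fac /o_fac /= la_gt0 b0.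
  rewrite (big_pred1 (ord0 : 'I_B.+1)) => [|s]; last by rewrite !inE m0 orbb.
  by rewrite m0 mulr_natl mulr2n /wt2 !sumn_rcons addn0.
have m_gt0 : (0 < m)%N by rewrite /m; lia.
have -> : fac = 1 by rewrite /fac /o_fac /= (negPf b_neq0) muln0.
rewrite (bigD1 (ord0 : 'I_B.+1)) //= mul1r {1}/wt2 sumn_rcons addn0; congr (_ + _).
rewrite (big_pred1 (Ordinal leB')) ?mul1r // => s; rewrite !inE -!val_eqE /=.
by case: eqP => [->|] //=; rewrite ?andbT // eq_sym gtn_eqF.
Qed.

Lemma skdet_ocolS (R : comUnitRingType) l mu (x : nat -> R) N B la :
  (0 < l)%N -> (forall i, x i \is a GRing.unit) ->
  gpart (l + N).+1 la -> (nth 0%N la 0 <= B)%N ->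
  skdet (l + N).+1 (ocol R l mu N.+1) (symP x N.+1) la
    = \sum_(b : {ffun 'I_(l + N) -> 'I_B.+1})
      \sum_(c : {ffun 'I_(l + N).+1 -> 'I_B.+1} |
        [&& interlace (rowseq c) la, interlace (rowseq b) (rowseq c)
        & (nth 0 (rowseq c) (l + N) \in
            [:: 0; minn (nth 0 la (l + N)) (nth 0 (rowseq b) (l + N).-1)])%N])
        (o_fac la (rowseq b) (l + N))%:R * wt2 (x N) la (rowseq c) (rowseq b)
        * skdet (l + N) (ocol R l mu N) (symP x N) (rowseq b).
Proof.
move=> l_gt0 xU gla leB.
have /andP[/eqP sz /sorted_geqP srt] := gla.
have leiB i : (nth 0 la i <= B)%N by elim: i => // i; apply: leq_trans.
have swap y : \sum_(c : {ffun 'I_(l + N) -> 'I_B.+1} | interlace (rowseq c) la)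
      \sum_(b : {ffun 'I_(l + N) -> 'I_B.+1} | interlace (rowseq b) (rowseq c))
        wt2 y la (rowseq c) (rowseq b)
        * skdet (l + N) (ocol R l mu N) (symP x N) (rowseq b)
  = \sum_(b : {ffun 'I_(l + N) -> 'I_B.+1})
      (\sum_(c : {ffun 'I_(l + N) -> 'I_B.+1} |
        interlace (rowseq c) la && interlace (rowseq b) (rowseq c))
        wt2 y la (rowseq c) (rowseq b))
        * skdet (l + N) (ocol R l mu N) (symP x N) (rowseq b).
  by rewrite (exchange_big_dep xpredT) //=; apply: eq_bigr => b _; rewrite mulr_suml.
rewrite (skdet_ocolS_sym mu xU gla leB) !swap {swap}.
transitivity (\sum_(b : {ffun 'I_(l + N) -> 'I_B.+1})
   (\sum_(c : {ffun 'I_(l + N) -> 'I_B.+1} |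
      interlace (rowseq c) la && interlace (rowseq b) (rowseq c))
      wt2 (x N) la (rowseq c) (rowseq b)
    + (if (0 < nth 0 la (l + N))%N then
      \sum_(c : {ffun 'I_(l + N) -> 'I_B.+1} |
        interlace (rowseq c) la && interlace (rowseq b) (rowseq c))
        wt2 (x N)^-1 la (rowseq c) (rowseq b) else 0))
    * skdet (l + N) (ocol R l mu N) (symP x N) (rowseq b)).
  case: ifP => _; last by rewrite addr0; apply: eq_bigr => b _; rewrite addr0.
  by rewrite -big_split; apply: eq_bigr => b _; rewrite mulrDl.
apply: eq_bigr => b _; rewrite -mulr_suml; congr (_ * _).
move: (size_rowseq b); move: (rowseq b) => {}b sz_b.
have e : (l + N = (l + N).-1.+1)%N by rewrite prednK // addn_gt0 l_gt0.
move: sz sz_b; rewrite e; move: (l + N).-1 => n sz sz_b.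
by rewrite sum_o_steps.
Qed.

(** * Sums over arrays *)

(** Without variables the entries compare the positions of la and mu.  If la and
    mu differ then some position of la is not one of mu, and its row is zero. *)
Lemma skdet_base (R : comUnitRingType) l mu la (p : nat -> {poly R}) :
  gpart l mu -> gpart l la ->
  (forall j, (j < l)%N -> p j = 'X^(nth 0%N mu j + (l - j.+1))) ->
  skdet l p 1 la = (la == mu)%:R.
Proof.
move=> /andP[/eqP sz_mu /sorted_geqP srt_mu] /andP[/eqP sz_la /sorted_geqP srt_la] pE.
pose pos s i := (nth 0 s i + (l - i.+1))%N.
pose poss s := mkseq (pos s) l.
have pos_lt s : (forall i, (nth 0 s i.+1 <= nth 0 s i)%N) ->
    forall i j, (i < j)%N -> (j < l)%N -> (pos s j < pos s i)%N.
  move=> srt i; elim=> // j IH; rewrite ltnS leq_eqVlt => /predU1P[<-|lt_ij] lt_j.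
    by rewrite /pos; have := srt i; lia.
  by apply: leq_trans (IH lt_ij (ltnW lt_j)); rewrite ltnS /pos; have := srt j; lia.
have gtn_tr : transitive gtn by move=> a b c /= h1 h2; apply: ltn_trans h1.
have gtn_irr : irreflexive gtn by move=> a; apply: ltnn.
have srt_pos s : (forall i, (nth 0 s i.+1 <= nth 0 s i)%N) -> sorted gtn (poss s).
  move=> srt; apply/(sortedP 0%N) => i; rewrite size_mkseq => lt_i.
  by rewrite !nth_mkseq ?(ltnW lt_i) //; apply: pos_lt.
case: eqP => [-> | ne].
  rewrite /skdet (@eq_ndet _ _ _ (fun i j => (i == j)%:R)).
    rewrite /ndet -[RHS](det1 _ l); congr (\det _).
    by apply/matrixP => i j; rewrite !mxE.
  move=> i j lt_i lt_j; rewrite pE // -[X in quo X]mul1r quoM ?coef1 // coefXn.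
  have := pos_lt mu srt_mu; rewrite /pos; case: (ltngtP i j) => [h H|h H|-> _].
  - by rewrite gtn_eqF // H.
  - by rewrite ltn_eqF // H.
  by rewrite eqxx.
case: (boolP (all (mem (poss mu)) (poss la))) => [/allP sub | /allPn[a]].
  have uniq_la : uniq (poss la) by apply: sorted_uniq (srt_pos _ srt_la).
  have [|_ eq_mem] := uniq_min_size uniq_la sub; first by rewrite !size_mkseq.
  have e : poss la = poss mu.
    by apply: (irr_sorted_eq gtn_tr gtn_irr) => //; apply: srt_pos.
  case: ne; apply: (@eq_from_nth _ 0%N) => [|i]; rewrite sz_la ?sz_mu // => lt_i.
  have /(congr1 (nth 0%N ^~ i)) := e; rewrite !nth_mkseq // /pos; lia.
case/mapP => i; rewrite mem_iota add0n => lt_i -> not_mu.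
rewrite /skdet /ndet (expand_det_row _ (Ordinal lt_i)) big1 // => j _.
rewrite mxE /= pE // -[X in quo X]mul1r quoM ?coef1 // coefXn.
case: eqP => [e|]; last by rewrite mul0r.
case/negP: not_mu; rewrite inE; apply/mapP; exists (val j).
  by rewrite mem_iota add0n ltn_ord.
by rewrite -/(pos la i) in e.
Qed.

Section Paths.
Variables (B M : nat).
Notation T := (M.-bseq 'I_B.+1).

Definition bnat (b : T) : seq nat := [seq val a | a <- (b : seq _)].

Lemma bnat_inj : injective bnat.
Proof. by move=> b b' /(inj_map val_inj) /val_inj. Qed.

Lemma sum_bnat (V : nmodType) n (G : seq nat -> V) : (n <= M)%N ->
  \sum_(b : T | size b == n) G (bnat b)
    = \sum_(f : {ffun 'I_n -> 'I_B.+1}) G (rowseq f).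
Proof.
move=> le_n.
pose h (f : {ffun 'I_n -> 'I_B.+1}) : T := insub_bseq M [seq f i | i <- enum 'I_n].
have hE f : h f = [seq f i | i <- enum 'I_n] :> seq _.
  by rewrite /h /insub_bseq val_insubd size_map size_enum_ord le_n.
pose k (b : T) : {ffun 'I_n -> 'I_B.+1} := [ffun i : 'I_n => nth ord0 b i].
rewrite (reindex_onto h k) => [|b /eqP sz]; last first.
  apply: val_inj; rewrite /= hE; apply: (@eq_from_nth _ ord0).
    by rewrite size_map size_enum_ord.
  rewrite size_map size_enum_ord => i lt_i.
  rewrite (nth_map (Ordinal lt_i)) ?size_enum_ord // ffunE.
  by rewrite nth_enum_ord.
apply: eq_big => [f | f _]; last by rewrite /bnat hE -map_comp.
rewrite hE size_map size_enum_ord eqxx /=; apply/eqP/ffunP => i.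
by rewrite ffunE hE (nth_map i) ?size_enum_ord // nth_ord_enum.
Qed.

Lemma bnat_surj n s : (n <= M)%N -> gpart n s -> (nth 0%N s 0 <= B)%N ->
  exists b, bnat b = s.
Proof.
move=> le_n /andP[/eqP sz /sorted_geqP srt] leB.
have leiB i : (nth 0 s i <= B)%N by elim: i => // i; apply: leq_trans.
exists (insub_bseq M [seq inord a | a <- s]).
rewrite /bnat /insub_bseq val_insubd size_map sz le_n -map_comp.
apply: map_id_in => a /(nthP 0%N)[i lt_i <-] /=.
by rewrite inordK // ltnS.
Qed.

Lemma ffrcons_widen (U : Type) n (f : {ffun 'I_n.+1 -> U}) a k : (k <= n)%N ->
  ffrcons f a (inord k) = f (inord k).
Proof.
move=> le_k; rewrite ffunE; have -> : inord k = lift ord_max (inord k : 'I_n.+1).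
  by apply: val_inj; rewrite /= !inordK ?ltnS // ?leqW // /bump; lia.
by rewrite liftK.
Qed.

Lemma ffrcons_max (U : Type) n (f : {ffun 'I_n -> U}) a : ffrcons f a (inord n) = a.
Proof.
rewrite ffunE; have -> : inord n = ord_max :> 'I_n.+1.
  by apply: val_inj; rewrite /= inordK.
by rewrite unlift_none.
Qed.

Variables (R : comPzRingType) (mu : seq nat).
Variable w : nat -> seq nat -> seq nat -> seq nat -> R.

(** A sum over arrays with a weight w on each pair of consecutive steps.  The
    number m + 1 of rows is kept apart from the number N of pairs, as the type of
    arrays depends on it. *)
Definition path_sum m N (la : seq nat) : R :=
  \sum_(t : {ffun 'I_m.+1 -> T})
    let z k := bnat (t (inord k)) in
    if (z 0 == mu) && (z m == la)
    then \prod_(i < N) w i (z (2 * i)%N) (z (2 * i).+1) (z (2 * i).+2) else 0.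

Lemma path_sum0 b : path_sum 0 0 (bnat b) = (bnat b == mu)%:R.
Proof.
rewrite /path_sum (bigD1 [ffun=> b]) //= ffunE eqxx andbT big_ord0.
rewrite big1 ?addr0 => [|t]; first by case: eqP.
move=> ne; rewrite big_ord0 ifF //; apply: contraNF ne => /andP[_ /eqP/bnat_inj e].
apply/eqP/ffunP => i; rewrite ffunE -e; congr (t _).
by apply: val_inj; rewrite /= inordK ?ord1.
Qed.

(** Split off the last two rows: the last one is prescribed, and the sum is
    organized by the value b of the row before them. *)
Lemma path_sumS N d :
  path_sum (2 * N.+1) N.+1 (bnat d)
    = \sum_(b : T) \sum_(c : T)
        w N (bnat b) (bnat c) (bnat d) * path_sum (2 * N) N (bnat b).
Proof.
have -> : (2 * N.+1 = (2 * N).+2)%N by lia.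
rewrite /path_sum sum_ffrcons sum_ffrcons /=.
pose W (t : {ffun 'I_(2 * N).+1 -> T}) := \prod_(i < N) w i (bnat (t (inord (2 * i))))
  (bnat (t (inord (2 * i).+1))) (bnat (t (inord (2 * i).+2))).
transitivity (\sum_(t : {ffun 'I_(2 * N).+1 -> T}) \sum_(c : T)
   if bnat (t (inord 0)) == mu
   then W t * w N (bnat (t (inord (2 * N)))) (bnat c) (bnat d) else 0).
  apply: eq_bigr => t _; apply: eq_bigr => c _.
  rewrite (bigD1 d) //= ffrcons_max eqxx andbT !ffrcons_widen //.
  rewrite [X in _ + X]big1 ?addr0 => [|a ne]; last first.
    by rewrite ffrcons_max (inj_eq bnat_inj) (negPf ne) andbF.
  case: ifP => // _; rewrite big_ord_recr /=.
  rewrite ffrcons_max ![ffrcons _ d _]ffrcons_widen ?ffrcons_max //; try lia.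
  rewrite ffrcons_widen //; congr (_ * _); apply: eq_bigr => i _.
  have lt_i := ltn_ord i.
  by rewrite !ffrcons_widen //; lia.
transitivity (\sum_(t : {ffun 'I_(2 * N).+1 -> T}) \sum_(c : T) \sum_(b : T)
   if (bnat (t (inord 0)) == mu) && (bnat (t (inord (2 * N))) == bnat b)
   then W t * w N (bnat b) (bnat c) (bnat d) else 0).
  apply: eq_bigr => t _; apply: eq_bigr => c _.
  rewrite [RHS](bigD1 (t (inord (2 * N)))) //= eqxx andbT big1 ?addr0 // => b ne.
  by rewrite (inj_eq bnat_inj) [t _ == b]eq_sym (negPf ne) andbF.
rewrite exchange_big /= [RHS]exchange_big /=; apply: eq_bigr => c _.
rewrite exchange_big /=; apply: eq_bigr => b _.
rewrite mulr_sumr; apply: eq_bigr => t _; case: ifP => _; last by rewrite mulr0.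
by rewrite mulrC.
Qed.

End Paths.

(** A function that satisfies the recursion of the path sums is the path sum. The
    recursion only sums over rows of the right length, which loses nothing as w
    vanishes on all others. *)
Lemma path_sum_solution (B M : nat) (R : comPzRingType) (mu : seq nat)
    (w : nat -> seq nat -> seq nat -> seq nat -> R) (D : nat -> seq nat -> R) l N la :
  (forall i b c s, ~~ (gpart (l + i) b && gpart (l + i).+1 c) -> w i b c s = 0) ->
  (forall s, gpart l s -> D 0%N s = (s == mu)%:R) ->
  (forall i s, gpart (l + i).+1 s -> (nth 0%N s 0 <= B)%N ->
     D i.+1 s = \sum_(b : {ffun 'I_(l + i) -> 'I_B.+1})
       \sum_(c : {ffun 'I_(l + i).+1 -> 'I_B.+1})
         w i (rowseq b) (rowseq c) s * D i (rowseq b)) ->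
  (l + N <= M)%N -> gpart (l + N) la -> (nth 0%N la 0 <= B)%N ->
  D N la = path_sum B M mu w (2 * N) N la.
Proof.
move=> w0 D0 DS; elim: N la => [|N IH] la le_M gla leB.
  rewrite addn0 in le_M gla; rewrite D0 //.
  by have [b <-] := bnat_surj le_M gla leB; rewrite path_sum0.
have [d eq_d] := bnat_surj le_M gla leB.
rewrite addnS in gla le_M; rewrite DS //.
rewrite -{2}eq_d path_sumS eq_d.
have restr n (F : M.-bseq 'I_B.+1 -> R) :
    (forall b : M.-bseq 'I_B.+1, size b != n -> F b = 0) ->
    \sum_b F b = \sum_(b : M.-bseq 'I_B.+1 | size b == n) F b.
  by move=> F0; rewrite [RHS]big_mkcond; apply: eq_bigr => b _; case: ifPn => // /F0.
have size_bnat n (b : M.-bseq 'I_B.+1) : size b != n -> gpart n (bnat b) = false.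
  by rewrite /gpart size_map => /negPf ->.
rewrite (restr (l + N)%N) => [|b ne]; last first.
  by rewrite big1 // => c _; rewrite w0 ?mul0r // size_bnat.
rewrite (@sum_bnat B M _ _ (fun b => \sum_c w N b (bnat c) la
  * path_sum B M mu w (2 * N) N b) (ltnW le_M)).
apply: eq_bigr => b _; rewrite (restr (l + N).+1) => [|c ne]; last first.
  by rewrite w0 ?mul0r // (size_bnat _ _ ne) andbF.
rewrite (@sum_bnat B M _ _ (fun c => w N (rowseq b) c la
  * path_sum B M mu w (2 * N) N (rowseq b)) le_M).
apply: eq_bigr => c _.
case: (boolP (gpart (l + N) (rowseq b))) => [gb | gb]; last first.
  by rewrite w0 ?mul0r // (negPf gb).
rewrite IH ?(ltnW le_M) //.
move: (l + N)%N b {gb} => [|n] b; first by rewrite nth_default ?size_rowseq.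
by rewrite -[X in nth _ _ X]/(nat_of_ord (@ord0 n)) nth_rowseq -ltnS.
Qed.

Definition local_pat l (i : nat) (b c s : seq nat) : bool :=
  [&& gpart (l + i) b, gpart (l + i).+1 c, interlace b c & interlace c s].

Definition sp_step (R : unitRingType) l (x : nat -> R) i b c s : R :=
  if local_pat l i b c s then wt2 (x i) s c b else 0.

Definition o_step (R : unitRingType) l (x : nat -> R) i b c s : R :=
  if local_pat l i b c s &&
     (nth 0 c (l + i) \in [:: 0; minn (nth 0 s (l + i)) (nth 0 b (l + i).-1)])%N
  then (o_fac s b (l + i))%:R * wt2 (x i) s c b else 0.

Lemma chain_local l N mu la (z : nat -> seq nat) :
  gpart l mu -> gpart (l + N) la ->
  chain l N mu la z = [&& z 0%N == mu, z (2 * N)%N == la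
    & [forall i : 'I_N, local_pat l i (z (2 * i)%N) (z (2 * i).+1) (z (2 * i).+2)]].
Proof.
move=> gmu gla; apply/and4P/and3P;
  [move=> [/forallP Hg z0 zN /forallP Hi] | move=> [z0 zN /forallP H]].
  split=> //; apply/forallP => i; have lt_i := ltn_ord i.
  have l0 : (2 * i < (2 * N).+1)%N by lia.
  have l1 : ((2 * i).+1 < (2 * N).+1)%N by lia.
  have k0 : (2 * i < 2 * N)%N by lia.
  have k1 : ((2 * i).+1 < 2 * N)%N by lia.
  apply/and4P; split.
  - by have := Hg (Ordinal l0); rewrite /= mul2n uphalf_double.
  - by have := Hg (Ordinal l1); rewrite /= mul2n doubleK addnS.
  - exact: Hi (Ordinal k0).
  - exact: Hi (Ordinal k1).
have parity k : (k < 2 * N)%N -> exists i : 'I_N, k = (2 * i)%N \/ k = (2 * i).+1.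
  move=> lt_k; have lt_i : (k./2 < N)%N by lia.
  by exists (Ordinal lt_i) => /=; lia.
split=> //; apply/forallP => -[k /= lt_k].
  move: lt_k; rewrite ltnS leq_eqVlt => /predU1P[-> | /parity[i []->]].
  - by rewrite (eqP zN) mul2n uphalf_double.
  - by have /and4P[gb _ _ _] := H i; rewrite mul2n uphalf_double -mul2n.
  by have /and4P[_ gc _ _] := H i; rewrite /= mul2n doubleK -mul2n addnS.
by have [i [] ->] := parity k lt_k; have /and4P[_ _] := H i.
Qed.

Lemma gt_ineqs_chain l N mu la z : chain l N mu la z -> gt_ineqs l N z.
Proof.
case/and4P => _ _ _ /forallP H; apply/forallP => k; apply/forallP => j.
apply/implyP => j_ge2; have /interlaceP/(_ (j - 1)%N) := H k.
by rewrite subn_gt0 j_ge2 -subSn ?subn1 ?(ltnW j_ge2) //; apply.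
Qed.

Lemma prod_if (R : comPzRingType) N (P : pred 'I_N) (F : 'I_N -> R) :
  \prod_(i < N) (if P i then F i else 0)
    = if [forall i, P i] then \prod_(i < N) F i else 0.
Proof.
case: ifPn => [/forallP H | /forallPn[i nP]].
  by apply: eq_bigr => i _; rewrite H.
by rewrite (bigD1 i) //= (negPf nP) mul0r.
Qed.

Lemma weight_wt2 (R : comUnitRingType) (y : R) z i :
  weight y z i.+1 = wt2 y (z (2 * i).+2) (z (2 * i).+1) (z (2 * i)%N).
Proof.
rewrite /weight /wt2; have -> : (2 * i.+1 = (2 * i).+2)%N by lia.
by rewrite subn1 subn2.
Qed.

Lemma sum_sp_pattern (R : comUnitRingType) l N (x : nat -> R) mu la :
  gpart l mu -> gpart (l + N) la ->
  \sum_(t : array l N la | sp_pattern l N mu la (rows t))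
        \prod_(i < N) weight (x i) (rows t) i.+1
  = path_sum (nth 0%N la 0) (l + N) mu (sp_step l x) (2 * N) N la.
Proof.
move=> gmu gla; rewrite big_mkcond; apply: eq_bigr => t _.
rewrite -/(rows t 0) -/(rows t (2 * N)) /=.
have -> : sp_pattern l N mu la (rows t) = chain l N mu la (rows t).
  by apply/andP/idP => [[]|h]; last by rewrite (gt_ineqs_chain h).
rewrite (chain_local _ gmu gla) andbA.
case: ((rows t 0 == mu) && (rows t (2 * N) == la)) => //=.
rewrite prod_if; case: ifP => // _.
by apply: eq_bigr => i _; rewrite weight_wt2.
Qed.

Lemma sum_o_pattern (R : comUnitRingType) l N (x : nat -> R) mu la :
  gpart l mu -> gpart (l + N) la ->
  \sum_(t : array l N la | o_pattern l N mu la (rows t))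
        \prod_(i < N) ((o_factor l (rows t) i.+1)%:R * weight (x i) (rows t) i.+1)
  = path_sum (nth 0%N la 0) (l + N) mu (o_step l x) (2 * N) N la.
Proof.
move=> gmu gla; rewrite big_mkcond; apply: eq_bigr => t _.
rewrite -/(rows t 0) -/(rows t (2 * N)) /=.
set z := rows t.
have dbl i : (2 * i.+1 = (2 * i).+2)%N by lia.
have -> : o_pattern l N mu la z = chain l N mu la z &&
   [forall i : 'I_N, (nth 0 (z (2 * i).+1) (l + i) \in
     [:: 0; minn (nth 0 (z (2 * i).+2) (l + i)) (nth 0 (z (2 * i)) (l + i).-1)])%N].
  apply/and3P/andP => [[h _ /forallP H] | [h /forallP H]].
    split=> //; apply/forallP => i; have lt_i : (i.+1 < N.+1)%N by exact: ltn_ord.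
    by have := H (Ordinal lt_i); rewrite /= /part dbl addnS !subn1 subn2.
  split=> //; first exact: gt_ineqs_chain h.
  apply/forallP => -[[|i] //= lt_i].
  by have := H (Ordinal (lt_i : (i < N)%N)); rewrite /= /part dbl addnS !subn1 subn2.
rewrite (chain_local _ gmu gla) -!andbA [X in if X then _ else _]andbA.
case: ((z 0%N == mu) && (z (2 * N)%N == la)) => //=.
rewrite prod_if.
have -> : forall P Q : pred 'I_N, [forall i, P i] && [forall i, Q i]
    = [forall i, P i && Q i].
  move=> P Q; apply/andP/forallP => [[/forallP p /forallP q] i|pq]; first by rewrite p q.
  by split; apply/forallP => i; case/andP: (pq i).
case: ifP => // _; apply: eq_bigr => i _; rewrite weight_wt2; congr (_%:R * _).
by rewrite /o_factor /o_fac /part dbl addnS subn1 subn2.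
Qed.

(** * The theorem *)

Lemma sp_recursion (R : comUnitRingType) l mu (x : nat -> R) B N la :
  (forall i, x i \is a GRing.unit) -> gpart l mu ->
  gpart (l + N).+1 la -> (nth 0%N la 0 <= B)%N ->
  skdet (l + N).+1 (spcol R l mu N.+1) (symP x N.+1) la
  = \sum_(b : {ffun 'I_(l + N) -> 'I_B.+1}) \sum_(c : {ffun 'I_(l + N).+1 -> 'I_B.+1})
      sp_step l x N (rowseq b) (rowseq c) la
      * skdet (l + N) (spcol R l mu N) (symP x N) (rowseq b).
Proof.
move=> xU /andP[/eqP sz_mu _] gla leB.
rewrite (skdet_spcolS xU _ gla leB) ?sz_mu // (exchange_big_dep xpredT) //=.
apply: eq_bigr => b _; rewrite big_mkcond; apply: eq_bigr => c _.
rewrite /sp_step /local_pat.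
have [c_la | _] /= := boolP (interlace (rowseq c) la); last by rewrite !andbF mul0r.
have [b_c | _] /= := boolP (interlace (rowseq b) (rowseq c));
  last by rewrite !andbF mul0r.
by rewrite (gpart_rowseq c_la) (gpart_rowseq b_c).
Qed.

Lemma o_recursion (R : comUnitRingType) l mu (x : nat -> R) B N la :
  (0 < l)%N -> (forall i, x i \is a GRing.unit) ->
  gpart (l + N).+1 la -> (nth 0%N la 0 <= B)%N ->
  skdet (l + N).+1 (ocol R l mu N.+1) (symP x N.+1) la
  = \sum_(b : {ffun 'I_(l + N) -> 'I_B.+1}) \sum_(c : {ffun 'I_(l + N).+1 -> 'I_B.+1})
      o_step l x N (rowseq b) (rowseq c) la
      * skdet (l + N) (ocol R l mu N) (symP x N) (rowseq b).
Proof.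
move=> l_gt0 xU gla leB; rewrite (skdet_ocolS mu l_gt0 xU gla leB).
apply: eq_bigr => b _; rewrite big_mkcond; apply: eq_bigr => c _.
rewrite /o_step /local_pat.
have [c_la | _] /= := boolP (interlace (rowseq c) la); last by rewrite !andbF mul0r.
have [b_c | _] /= := boolP (interlace (rowseq b) (rowseq c));
  last by rewrite !andbF mul0r.
rewrite (gpart_rowseq c_la) (gpart_rowseq b_c) /=.
by case: ifP => // _; rewrite mul0r.
Qed.

Section Entries.
Variables (R : comUnitRingType) (N : nat) (x : 'I_N -> R).

(** Extending the variables by 1 lets the induction on N use one family. *)
Definition extend (k : nat) : R := if insub k is Some i then x i else 1.

Lemma extendE (i : 'I_N) : extend i = x i.
Proof. by rewrite /extend valK. Qed.

Lemma extend_unit : (forall i, x i \is a GRing.unit) ->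
  forall k, extend k \is a GRing.unit.
Proof.
move=> xU k; rewrite /extend.
by case: insub => [i|]; [exact: xU | exact: unitr1].
Qed.

Lemma quo_hsym s a : quo 'X^s (symP extend N) a = hsym x (a%:Z - s%:Z).
Proof.
rewrite quoXn; case: leqP => h.
  rewrite subzn //=; congr (inv_series _ _).
  by apply: eq_bigr => i _; rewrite extendE.
by have -> : a%:Z - s%:Z = Negz (s - a).-1 by lia.
Qed.

Lemma skew_spE l la mu : (size mu <= l)%N ->
  skew_sp l x la mu = skdet (l + N) (spcol R l mu N) (symP extend N) la.
Proof.
move=> sz.
apply: (@eq_ndet _ _ (fun i j => sp_entry l x la mu i.+1 j.+1)) => i j lt_i lt_j.
rewrite /sp_entry /spcol /part /= ltnS.
case: leqP => h; rewrite ?quoD !quo_hsym.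
  by congr (hsym x _); lia.
by congr (hsym x _ + hsym x _); lia.
Qed.

Lemma skew_oE l la mu :
  skew_o l x la mu = skdet (l + N) (ocol R l mu N) (symP extend N) la.
Proof.
apply: (@eq_ndet _ _ (fun i j => o_entry l x la mu i.+1 j.+1)) => i j lt_i lt_j.
rewrite /o_entry /ocol /part /=.
case: ltnP => h; rewrite ?quoB !quo_hsym.
  by congr (hsym x _); lia.
by congr (hsym x _ - hsym x _); lia.
Qed.

End Entries.

Unset Implicit Arguments.

Theorem theorem4p6 (R : comUnitRingType) (l N : nat)
    (x : 'I_N -> R) (mu la : seq nat)
    (hl : (1 <= l)%N) (hN : (1 <= N)%N)
    (hx : forall i : 'I_N, x i \is a GRing.unit)
    (hmu : gpart l mu) (hla : gpart (l + N) la) (hsub : subpart mu la) :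
  skew_sp l x la mu
    = \sum_(t : array l N la | sp_pattern l N mu la (rows t))
        \prod_(i < N) weight (x i) (rows t) i.+1
  /\
  skew_o l x la mu
    = \sum_(t : array l N la | o_pattern l N mu la (rows t))
        \prod_(i < N) ((o_factor l (rows t) i.+1)%:R * weight (x i) (rows t) i.+1).
Proof.
have xU := extend_unit hx.
have sz_mu : (size mu <= l)%N by case/andP: hmu => /eqP ->.
have symP0 : symP (extend x) 0 = 1 by rewrite /symP big_ord0.
split.
  rewrite (skew_spE _ _ sz_mu).
  under eq_bigr do under eq_bigr do rewrite -extendE.
  rewrite sum_sp_pattern //.
  apply: (@path_sum_solution _ _ _ _ _ (fun i s =>
      skdet (l + i) (spcol R l mu i) (symP (extend x) i) s)) => //.
  - by move=> i b c s; rewrite /sp_step /local_pat => /negPf; rewrite andbA => ->.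
  - move=> s gs; rewrite symP0 addn0 (skdet_base hmu gs) // => j lt_j.
    by rewrite /spcol ltnW // addn0.
  - by move=> i s gs leB; rewrite addnS; exact: sp_recursion.
rewrite skew_oE.
under eq_bigr do under eq_bigr do rewrite -extendE.
rewrite sum_o_pattern //.
apply: (@path_sum_solution _ _ _ _ _ (fun i s =>
    skdet (l + i) (ocol R l mu i) (symP (extend x) i) s)) => //.
- by move=> i b c s; rewrite /o_step /local_pat => /negPf; rewrite andbA => ->.
- move=> s gs; rewrite symP0 addn0 (skdet_base hmu gs) // => j lt_j.
  by rewrite /ocol lt_j addn0.
- by move=> i s gs leB; rewrite addnS; exact: o_recursion.
Qed.
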